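(* Let $H=H_n$ be an $n$-vertex graph of one of the following types, with $n\to\infty$: (1) a spanning tree (a tree on $n$ vertices) whose maximum degree is bounded by a fixed constant $d$; (2) the $m$-th power of a Hamiltonian cycle on $n$ vertices, for some fixed integer $m\ge1$; (3) an $F$-factor on $n$ vertices, for some fixed graph $F$ with at least one edge (where $v_F\mid n$). Then $p_2(H)=O(q(H))$, where the implicit constant may depend on the maximum degree bound $d$, on $m$, or on $F$, as appropriate, but not on $n$ (nor otherwise on $H$).
   Context: Graphs are finite and simple; $v_F$ is the number of vertices of $F$. For a finite set $X$ and $p\in[0,1]$, $\mu_p$ is the product measure on $2^X$: $\mu_p(\{A\})=p^{|A|}(1-p)^{|X\setminus A|}$. A family $\mathcal F\subseteq 2^X$ is increasing if closed under supersets and decreasing if closed under subsets. For a decreasing family $\mathcal D\subseteq 2^X$, $\mathcal D_{(k)}:=\{D_1\cup\cdots\cup D_k: D_i\in\mathcal D\}$. For an increasing family $\mathcal I\subseteq 2^X$, the $k$-threshold $p_k(\mathcal I)$ is the infimum of the set of $p\in[0,1]$ such that for every decreasing $\mathcal D\subseteq 2^X$ with $\mu_p(\mathcal D)\ge 1-\frac1{2k}$ we have $\mathcal D_{(k)}\cap\mathcal I\neq\emptyset$. For $S\subseteq X$ let $\langle S\rangle:=\{T\subseteq X:T\supseteq S\}$. A family $\mathcal I\subseteq2^X$ is $p$-small if there is $\mathcal G\subseteq 2^X$ with $\mathcal I\subseteq\bigcup_{S\in\mathcal G}\langle S\rangle$ and $\sum_{S\in\mathcal G}\mu_p(\langle S\rangle)\le1/2$.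 The expectation threshold is $q(\mathcal I)=\max\{p:\mathcal I\text{ is }p\text{-small}\}$. Take $X=\binom{[n]}2$ and identify elements of $2^{\binom{[n]}2}$ with graphs on vertex set $[n]$. For a graph $H$ on at most $n$ vertices, $\mathcal I_H\subseteq 2^{\binom{[n]}2}$ is the family of all graphs on $[n]$ having a subgraph isomorphic to $H$; $p_k(H):=p_k(\mathcal I_H)$ and $q(H):=q(\mathcal I_H)$. The $m$-th power of a Hamiltonian cycle is the graph on $n$ vertices in which two distinct vertices are adjacent iff their distance in a fixed Hamiltonian cycle is at most $m$. An $F$-factor on $[n]$ is a collection of $n/v_F$ copies of $F$ whose vertex sets partition $[n]$. It is assumed throughout that $n$ is sufficiently large (in terms of the fixed parameters). *)

(* Defs.v *)
From mathcomp Require Import all_boot all_order all_algebra.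
From mathcomp Require Import all_classical all_reals all_analysis.

Set Implicit Arguments.
Unset Strict Implicit.
Unset Printing Implicit Defensive.

Import Order.TTheory GRing.Theory Num.Theory.
Import numFieldNormedType.Exports.

Local Open Scope ring_scope.

(* In this file [{set T}] is the type of finite sets over a finType, so that
   [{set {set X}}] is the type of families F of subsets of X; [set R] (only
   used to form [inf] and [sup]) is the type of sets of real numbers. *)

Section Families.
Context {R : realType} {X : finType}.
Implicit Types (p : R) (k : nat) (S A B : {set X}) (F D I G : {set {set X}}).

Definition mu p F : R := \sum_(A in F) p ^+ #|A| * (1 - p) ^+ #|~: A|.

Definition increasing F := forall A B, A \subset B -> A \in F -> B \in F.

Definition decreasing F := forall A B, A \subset B -> B \in F -> A \in F.

Definition kfold_union D k : {set {set X}} :=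
  [set \bigcup_(i < k) f i | f : {ffun 'I_k -> {set X}} in ffun_on D]%SET.

Definition k_admissible k I p : Prop :=
  forall D, decreasing D -> 1 - 1 / (2 * k%:R) <= mu p D ->
    kfold_union D k :&: I != finset.set0.

Definition k_threshold k I : R :=
  inf [set p | 0 <= p <= 1 /\ k_admissible k I p]%classic.

Definition up S : {set {set X}} := [set T : {set X} | S \subset T]%SET.

Definition p_small p I : Prop :=
  exists G, I \subset \bigcup_(S in G) up S /\
    \sum_(S in G) mu p (up S) <= 1 / 2.

(* The supremum is a maximum, see [expectation_threshold_max]; it is 0 in the
   degenerate case [set0 \in I], where I is p-small for no p. *)
Definition expectation_threshold I : R :=
  sup [set p | 0 <= p <= 1 /\ p_small p I]%classic.

End Families.

Section Graphs.
Context {V : finType}.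

Definition edge := {e : {set V} | #|e| == 2%N}.

Definition graph := {set edge}.

Implicit Types (H C : graph) (x y : V).

Definition edges H : {set {set V}} := [set val e | e in H]%SET.

Definition adj H : rel V := fun x y => [set x; y]%SET \in edges H.

Definition degree H x : nat := #|[set y | adj H x y]%SET|.

Definition max_degree H : nat := (\max_(x : V) degree H x)%N.

Definition connected H : Prop := forall x y, connect (adj H) x y.

Definition acyclic H : Prop :=
  forall c : seq V, (2 < size c)%N -> ~ ucycle (adj H) c.

Definition is_tree H : Prop := [/\ (0 < #|V|)%N, connected H & acyclic H].

Definition distance_le H (m : nat) x y : Prop :=
  exists s : seq V, [/\ path (adj H) x s, last x s = y & (size s <= m)%N].

(* C is a Hamiltonian cycle on V: [c] lists the vertices in cyclic order. *)
Definition is_hamiltonian_cycle C : Prop :=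
  exists c : seq V, [/\ (2 < size c)%N, uniq c, (forall x, x \in c)
    & edges C = [set [set x; next c x]%SET | x : V]%SET].

Definition is_hamiltonian_cycle_power (m : nat) H : Prop :=
  exists2 C, is_hamiltonian_cycle C &
    forall x y, x != y -> adj H x y <-> distance_le C m x y.

End Graphs.

Arguments edge V : clear implicits.
Arguments graph V : clear implicits.

(* Edge set of the image of F under [f]; when [f] is injective, [f @: setT] and
   [copy_edges F f] are the vertex set and edge set of a copy of F. *)
Definition copy_edges {U V : finType} (F : graph U) (f : U -> V) :
    {set {set V}} :=
  [set [set f x | x in e]%SET | e : {set U} in edges F]%SET.

Definition is_factor {U V : finType} (F : graph U) (H : graph V) : Prop :=
  (#|U| %| #|V|)%N /\
  exists f : 'I_(#|V| %/ #|U|) -> U -> V,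
    [/\ forall i, injective (f i),
        forall i j, i != j ->
          [disjoint [set f i u | u : U]%SET & [set f j u | u : U]%SET],
        \bigcup_i [set f i u | u : U]%SET = [set: V]%SET
      & edges H = \bigcup_i copy_edges F (f i)].

Definition has_copy {V W : finType} (H : graph V) (G : graph W) : Prop :=
  exists f : V -> W, injective f /\ copy_edges H f \subset edges G.

Definition I_ (n : nat) {V : finType} (H : graph V) : {set graph 'I_n} :=
  [set G | `[< has_copy H G >]]%SET.

Definition p_ {R : realType} (k n : nat) {V : finType} (H : graph V) : R :=
  k_threshold k (I_ n H).

Definition q_ {R : realType} (n : nat) {V : finType} (H : graph V) : R :=
  expectation_threshold (I_ n H).

Lemma I_increasing (n : nat) (V : finType) (H : graph V) :
  increasing (I_ n H).
Proof.
move=> A B sAB; rewrite !inE => -[f [injf sf]]; exists f; split=> //.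
by apply: (fintype.subset_trans sf); apply: imsetS.
Qed.

Lemma expectation_threshold_max (R : realType) (X : finType)
    (I : {set {set X}}) : finset.set0 \notin I ->
  [/\ 0 <= (expectation_threshold I : R) <= 1,
      p_small (expectation_threshold I : R) I
    & forall p : R, 0 <= p <= 1 -> p_small p I ->
        p <= expectation_threshold I].
Proof.
move=> I0; set E := ([set p : R | 0 <= p <= 1 /\ p_small p I]%classic).
have E0 : E 0.
  split; first by rewrite lexx ler01.
  exists I; split.
    by apply/fintype.subsetP => A AI; apply/bigcupP; exists A; rewrite ?inE.
  rewrite big1 ?divr_ge0// => S SI; rewrite /mu big1// => A.
  rewrite inE => sSA; rewrite expr0n cards_eq0.
  case: eqP => [A0|_]; last by rewrite mul0r.
  by move: sSA I0; rewrite A0 finset.subset0 => /eqP <-; rewrite SI.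
have ubE : has_ubound E by exists 1 => p [/andP[]].
have clE : closed E.
  have -> : E = (\bigcup_(G in [set G : {set {set X}} |
      (I \subset \bigcup_(S in G) up S)%SET])
      ([set p : R | (0 <= p)%R] `&` [set p : R | (p <= 1)%R] `&`
       [set p : R | (\sum_(S in G) mu p (up S) <= 1 / 2)%R]))%classic.
    apply/seteqP; split=> p /=.
      by move=> [/andP[p0 p1] [G [sG leG]]]; exists G.
    by move=> [G sG [[/= p0 p1] leG]]; split; [rewrite p0|exists G].
  apply: closed_bigcup; first exact: finite_finset.
  move=> G _; apply: closedI.
    by apply: closedI; [exact: closed_ge|exact: closed_le].
  apply: (@preimage_closed _ _ (fun p : R => \sum_(S in G) mu p (up S)) _ _
    (@closed_le R (1 / 2))).
  move=> p _; apply: cvg_big => // [|S _]; first exact: add_continuous.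
  apply: cvg_big => // [|A _]; first exact: add_continuous.
  apply: cvgM; first exact: exprn_continuous.
  apply: (@continuous_comp _ _ _ (fun t : R => 1 - t)
    (fun t : R => t ^+ #|~: A|)); last exact: exprn_continuous.
  by apply: cvgB; [exact: cvg_cst|exact: cvg_id].
have [Eq1 Eq2] : E (sup E).
  by apply: clE; apply: closure_sup => //; exists 0.
by split=> // p p01 sp; apply: ub_le_sup.
Qed.

(* Main.v *)
Require Import Defs.
From mathcomp Require Import all_boot all_order all_algebra.
From mathcomp Require Import all_classical all_reals all_analysis.
From mathcomp Require Import perm fintype finset ring lra zify.

(* Fix p at which I_H is not p-small, and write H as a union A u B of two graphs
   which each leave a positive proportion of the vertices isolated and have
   components of bounded size. Since the obvious families (all copies of H, or
   all collections of disjoint copies of a subgraph of F) do not witness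
   p-smallness, every set S of vertices of a component of A or B spanning e > 0
   edges satisfies p^e n^(|S|-1) >= c. For a large constant C, Janson's
   inequality at Cp then bounds by exp(-15n) the probability that a given set of
   linearly many vertices contains no copy of a given component, so by a union
   bound the components of A can be embedded greedily: the random graph at Cp
   contains a copy of A, and likewise of B, with probability > 3/4. If D is
   decreasing with measure >= 3/4 then, permuting the vertices randomly, more
   than half of all placements of A, and of B, belong to D; hence some common
   placement puts both in D, and their union contains H.

   Splittings: a tree is cut according to depth mod 4 (edge levels 0,1 | 2,3),
   the power of a cycle into alternating blocks of 2m starting points, and a
   factor into two halves. *)

Set Implicit Arguments.
Unset Strict Implicit.
Unset Printing Implicit Defensive.

Import Order.TTheory GRing.Theory Num.Theory.

Local Open Scope ring_scope.

(** * The product measure *)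

(** Why [H] is cut in two: at a constant multiple of [1/n] a random graph has isolated vertices, and
    a greedy embedding of a spanning graph fails near its end, when few vertices are free. If a
    positive proportion of the vertices is isolated in each half, every component is placed among
    linearly many free vertices, and these can be chosen adversarially: there are at most
    [n * 2 ^ n <= 4 ^ n] pairs of a component and a free set, each failing with probability at most
    [16 ^- n]. The failure exponent is linear in [n] because [p^e n^(|S|-1) >= c] says that each
    piece of a component has at least of order [n] expected copies, and the scarcest piece governs
    Janson's exponent. The level 3/4 is [1 - 1/(2k)] at [k = 2]: two events of that measure, one of
    them strictly above it, meet in measure more than 1/2, which lets the two halves share a
    placement. *)

Section ProductMeasure.
Context {R : realType} {X : finType}.
Implicit Types (p : R) (S A B : {set X}) (F D : {set {set X}}).

Lemma mu_ge0 p F : 0 <= p <= 1 -> 0 <= mu p F.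
Proof.
move=> /andP[p0 p1]; apply: sumr_ge0 => A _.
by rewrite mulr_ge0 ?exprn_ge0 ?subr_ge0.
Qed.

Lemma mu_setT p : mu p [set: {set X}]%SET = 1.
Proof.
have := @bigA_distr R 0 1 *%R +%R X (fun=> p) (fun=> 1 - p).
rewrite big1 => [->|i _]; last by rewrite /= addrCA subrr addr0.
apply: eq_big => [A|A _]; first by rewrite inE.
rewrite (bigID (mem A)) /=; congr (_ * _).
  rewrite (eq_bigr (fun=> p)) => [|i ->//]; by rewrite prodr_const.
rewrite (eq_bigr (fun=> 1 - p)) => [|i /negbTE ->//]; rewrite prodr_const.
by congr (_ ^+ _); apply: eq_card => i; rewrite !inE.
Qed.

Lemma mu_subset p F D : 0 <= p <= 1 -> F \subset D -> mu p F <= mu p D.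
Proof.
move=> /andP[p0 p1] sFD; rewrite /mu [leRHS](big_setID F)/=.
rewrite (setIidPr sFD) lerDl sumr_ge0// => A _.
by rewrite mulr_ge0 ?exprn_ge0 ?subr_ge0.
Qed.

Lemma muID p F D : mu p F = mu p (F :&: D)%SET + mu p (F :\: D)%SET.
Proof. exact: big_setID. Qed.

Lemma mu_setC p F : mu p (~: F)%SET = 1 - mu p F.
Proof.
rewrite -(mu_setT p) (muID p [set: {set X}]%SET F) setTI setTD.
by rewrite addrAC subrr add0r.
Qed.

Lemma mu_setU p F D : 0 <= p <= 1 -> mu p (F :|: D)%SET <= mu p F + mu p D.
Proof.
move=> p01; rewrite (muID p _ F) setUK lerD2l.
by apply: mu_subset => //; rewrite setDUl setDv set0U subsetDl.
Qed.

Lemma mu_bigcup (I : finType) (P : pred I) p (F : I -> {set {set X}}) :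
  0 <= p <= 1 -> mu p (\bigcup_(i | P i) F i)%SET <= \sum_(i | P i) mu p (F i).
Proof.
move=> p01; elim/big_rec2: _ => [|i x A _ H]; first by rewrite /mu big_set0.
by apply: le_trans (mu_setU _ _ p01) _; rewrite lerD2l.
Qed.

(** Conditioning on one coordinate: given [x \in A], the random set is distributed as [x |: A]. *)
Lemma mu_mem p F (x : X) :
  mu p [set A in F | x \in A]%SET = p * mu p [set A | (x |: A)%SET \in F]%SET.
Proof.
rewrite (muID p [set A | (x |: A)%SET \in F]%SET [set A : {set X} | x \in A]%SET) mulrDr.
have -> : ([set A | (x |: A)%SET \in F] :&: [set A : {set X} | x \in A])%SET =
    [set A in F | x \in A]%SET.
  apply/setP=> A; rewrite !inE; case xA: (x \in A); rewrite ?andbF// !andbT.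
  by rewrite (setUidPr _)// sub1set.
(* Deleting [x] is a bijection onto the sets avoiding [x], and trades one factor [p] for [1 - p]. *)
suff -> : p * mu p ([set A | (x |: A)%SET \in F] :\: [set A : {set X} | x \in A])%SET =
    (1 - p) * mu p [set A in F | x \in A]%SET by ring.
rewrite /mu !big_distrr/= (reindex_onto (fun A => A :\ x)%SET (fun A => x |: A)%SET)/=; last first.
  by move=> A; rewrite !inE => /andP[xA _]; rewrite setU1K.
apply: eq_big => [A|A].
  rewrite !inE eqxx/=; case xA: (x \in A).
    by rewrite setD1K// eqxx !andbT.
  rewrite andbF; apply/negP => /andP[_ /eqP e]; move: xA; rewrite -e !inE eqxx//.
rewrite !inE eqxx/= => /andP[_ /eqP e].
have xA : x \in A by rewrite -e !inE eqxx.
have -> : (~: (A :\ x) = x |: ~: A)%SET.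
  by apply/setP=> y; rewrite !inE negb_and negbK.
rewrite cardsU1 !inE xA/= [#|A|](cardsD1 x A) xA /= !exprD !expr1; ring.
Qed.

(** Source of all independence and correlation in Janson's inequality: if membership in [F] ignores
    [S] the right side is a product of measures, and if [F] is decreasing it is at most that
    product, the case of Harris' inequality needed. *)
Lemma mu_upI p S F :
  mu p (up S :&: F)%SET = p ^+ #|S| * mu p [set A | (S :|: A)%SET \in F]%SET.
Proof.
elim: {S}_.+1 {-2}S (ltnSn #|S|) F => // n IH S leS F.
have [->|[x xS]] := set_0Vmem S.
  rewrite cards0 expr0 mul1r; congr (mu p _); apply/setP => A.
  by rewrite !inE sub0set set0U.
pose S' := (S :\ x)%SET.
have defS : (x |: S')%SET = S by rewrite setD1K.
have -> : (up S :&: F = [set A in up S' :&: F | x \in A])%SET.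
  apply/setP => A; rewrite !inE -{1}defS subUset sub1set -!andbA.
  by case: (x \in A) => /=; rewrite ?andbT ?andbF.
rewrite mu_mem.
have -> : ([set A | x |: A \in up S' :&: F] = up S' :&: [set A | x |: A \in F])%SET.
  apply/setP => A; rewrite !inE; congr (_ && _).
  by rewrite /S' !subDset setUA setUid.
rewrite IH; last by rewrite -ltnS (leq_trans _ leS)// ltnS (cardsD1 x S) xS.
rewrite mulrA -exprS (cardsD1 x S) xS add1n; congr (_ * mu p _).
by apply/setP => A; rewrite !inE setUA defS.
Qed.

Lemma mu_up p S : mu p (up S) = p ^+ #|S|.
Proof.
rewrite -[up S]setIT mu_upI -[RHS]mulr1; congr (_ * _).
by rewrite -(mu_setT p); congr mu; apply/setP=> A; rewrite !inE.
Qed.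

End ProductMeasure.

(** * Janson's inequality *)

Section Janson.
Context {R : realType} {X I : finType} (S : I -> {set X}).
Implicit Types (p : R) (Q : {set I}).

Definition avoid Q : {set {set X}} :=
  [set A : {set X} | [forall i in Q, ~~ (S i \subset A)]]%SET.

Definition overlap (i j : I) := (j != i) && ~~ [disjoint S i & S j].

(** Split [Q] into the sets disjoint from [S a] and those meeting it. Avoiding the former is
    independent of [up (S a)]; the latter enter through a union bound. This bounds from below the
    measure lost when [a] is added. *)
Lemma avoid_step p Q a : 0 <= p <= 1 -> a \notin Q ->
  mu p (avoid (a |: Q)%SET) <=
    mu p (avoid Q) * (1 + (\sum_(j in Q | overlap a j) p ^+ #|(S a :|: S j)%SET| - p ^+ #|S a|)).
Proof.
move=> p01 aQ; have [p0 p1] := andP p01.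
set sg := \sum_(j in Q | _) _.
suff H : mu p (avoid Q) * (p ^+ #|S a| - sg) <= mu p (up (S a) :&: avoid Q)%SET.
  have -> : avoid (a |: Q)%SET = (avoid Q :\: up (S a))%SET.
    apply/setP => A; rewrite !inE; apply/forall_inP/andP => [H1|[H1 /forall_inP H2] i].
      split; first by apply: H1; rewrite !inE eqxx.
      by apply/forall_inP => i iQ; apply: H1; rewrite !inE iQ orbT.
    by rewrite !inE => /orP[/eqP ->//|]; apply: H2.
  have := muID p (avoid Q) (up (S a)); rewrite setIC in H; lra.
have [le0|/ltW ge0] := leP (p ^+ #|S a| - sg) 0.
  by apply: le_trans (mu_ge0 _ p01); rewrite mulr_ge0_le0 ?mu_ge0.
pose Q0 := [set j in Q | [disjoint S a & S j]]%SET.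
pose D0 := avoid Q0.
have sD : avoid Q \subset D0.
  apply/subsetP => A; rewrite !inE => /forall_inP H; apply/forall_inP => i.
  by rewrite inE => /andP[iQ _]; exact: H.
apply: (@le_trans _ _ (mu p D0 * (p ^+ #|S a| - sg))).
  by rewrite ler_wpM2r// mu_subset.
rewrite mulrBr lerBlDr.
have -> : mu p D0 * p ^+ #|S a| = mu p (up (S a) :&: D0)%SET.
  rewrite mu_upI mulrC; congr (_ * mu p _); apply/setP => A; rewrite !inE.
  apply: eq_forallb => j; rewrite inE; case: (j \in Q) => //=.
  case dj: [disjoint S a & S j] => //=; congr (~~ _).
  by rewrite -[in RHS]subDset (setDidPl _)// disjoint_sym.
apply: (@le_trans _ _ (mu p ((up (S a) :&: avoid Q) :|:
    \bigcup_(j in Q | overlap a j) (up (S a :|: S j) :&: D0))%SET)).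
  apply: mu_subset => //; apply/subsetP => A; rewrite !inE => /andP[sA AD].
  rewrite sA /=; case: forall_inP => //= nA; apply/bigcupP.
  have /exists_inP[j jQ]: [exists j in Q, S j \subset A].
    by apply/contra_notT : nA; rewrite negb_exists_in => /forall_inP.
  move=> sjA; exists j; last by rewrite !inE subUset sA sjA AD.
  rewrite jQ /overlap /=; apply/andP; split; first by apply: contraNneq aQ => <-.
  apply: contraL sjA => dj; move: (AD) => /forall_inP; apply.
  by rewrite inE jQ.
apply: le_trans (mu_setU _ _ p01) _; rewrite lerD2l.
apply: le_trans (mu_bigcup _ _ p01) _; rewrite mulr_sumr; apply: ler_sum => j _.
(* [D0] is decreasing, so forcing [S a :|: S j] into the random set only lowers its measure. *)
rewrite mu_upI mulrC ler_wpM2r ?exprn_ge0// mu_subset//.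
apply/subsetP => A; rewrite !inE => /forall_inP H; apply/forall_inP => i iQ.
by apply: contra (H _ iQ) => sA; apply: subset_trans sA (subsetUr _ _).
Qed.

(** Multiply the factors of [avoid_step], using [1 + x <= e ^ x]. The inner sums are enlarged to all
    of [Q], so each overlapping pair counts in both orders; the factor 2 lost against the usual
    exponent only changes constants. *)
Lemma janson p Q : 0 <= p <= 1 ->
  mu p (avoid Q) <= expR (\sum_(i in Q)
    (\sum_(j in Q | overlap i j) p ^+ #|(S i :|: S j)%SET| - p ^+ #|S i|)).
Proof.
move=> p01; have [p0 p1] := andP p01.
elim: {Q}_.+1 {-2}Q (ltnSn #|Q|) => // n IH Q leQ.
have [->|[a aQ]] := set_0Vmem Q.
  rewrite big_set0 expR0 -(@mu_setT _ X p); apply: mu_subset => //; exact: subsetT.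
pose Q' := (Q :\ a)%SET; have defQ : (a |: Q')%SET = Q by rewrite setD1K.
have aQ' : a \notin Q' by rewrite !inE eqxx.
rewrite (big_setD1 a)//= -/Q' -{1}defQ.
apply: le_trans (avoid_step p01 aQ') _.
apply: (@le_trans _ _ (mu p (avoid Q') *
    expR (\sum_(j in Q' | overlap a j) p ^+ #|(S a :|: S j)%SET| - p ^+ #|S a|))).
  by rewrite ler_wpM2l ?mu_ge0// expR_ge1Dx.
rewrite [leRHS]expRD [leLHS]mulrC; apply: ler_pM; rewrite ?expR_ge0 ?mu_ge0//.
  rewrite ler_expR lerD2r; rewrite [leLHS]big_mkcond [leRHS]big_mkcond/=.
  apply: ler_sum => j _; rewrite !inE; case: (j != a) => /=.
    by case: ifP.
  by case: ifP => // _; rewrite exprn_ge0.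
apply: le_trans (IH _ _) _.
  by rewrite -ltnS (leq_trans _ leQ)// ltnS (cardsD1 a Q) aQ.
rewrite ler_expR; apply: ler_sum => i _; rewrite lerD2r.
rewrite [leLHS]big_mkcond [leRHS]big_mkcond/=.
apply: ler_sum => j _; rewrite !inE; case: (j != a) => /=; first by case: ifP.
by case: ifP => // _; rewrite exprn_ge0.
Qed.

(* Averaging Janson's bound over a [mu theta]-random subfamily. *)
Lemma janson_sparse p (theta : R) : 0 <= p <= 1 -> 0 <= theta <= 1 ->
  mu p (avoid [set: I]%SET) <= expR (theta ^+ 2 * (\sum_i
    \sum_(j | overlap i j) p ^+ #|(S i :|: S j)%SET|) - theta * \sum_i p ^+ #|S i|).
Proof.
move=> p01 t01; have [p0 p1] := andP p01; have [t0 t1] := andP t01.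
pose b i j := p ^+ #|(S i :|: S j)%SET|.
pose g Q := \sum_(i in Q) (\sum_(j in Q | overlap i j) b i j - p ^+ #|S i|).
pose wt Q := theta ^+ #|Q| * (1 - theta) ^+ #|~: Q|.
have wt0 Q : 0 <= wt Q by rewrite mulr_ge0 ?exprn_ge0 ?subr_ge0.
have E : \sum_Q wt Q * g Q =
    theta ^+ 2 * (\sum_i \sum_(j | overlap i j) b i j) - theta * \sum_i p ^+ #|S i|.
  have sup Q' : \sum_(Q : {set I} | Q' \subset Q) wt Q = theta ^+ #|Q'|.
    by rewrite -mu_up; apply: eq_bigl => Q; rewrite inE.
  transitivity (\sum_(Q : {set I}) (\sum_i \sum_(j | overlap i j)
      (if [set i; j]%SET \subset Q then wt Q * b i j else 0)
      - \sum_i if [set i]%SET \subset Q then wt Q * p ^+ #|S i| else 0)).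
    apply: eq_bigr => Q _; rewrite /g mulr_sumr big_mkcond -sumrB/=.
    apply: eq_bigr => i _; rewrite sub1set; case iQ: (i \in Q); last first.
      rewrite subr0 big1// => j _; by rewrite subUset sub1set iQ.
    rewrite mulrBr; congr (_ - _); rewrite mulr_sumr big_mkcondl/=.
    by apply: eq_bigr => j _; rewrite subUset !sub1set iQ; case: ifP => //; rewrite mulr0.
  rewrite sumrB; congr (_ - _).
    rewrite exchange_big mulr_sumr; apply: eq_bigr => i _ /=.
    rewrite exchange_big mulr_sumr; apply: eq_bigr => j /andP[ji _] /=.
    by rewrite -big_mkcond/= -mulr_suml sup cards2 eq_sym ji.
  rewrite exchange_big mulr_sumr; apply: eq_bigr => i _ /=.
  by rewrite -big_mkcond/= -mulr_suml sup cards1.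
rewrite -E.
have [Q _ Qmin] := @arg_minP _ _ _ set0 xpredT g isT.
apply: (@le_trans _ _ (mu p (avoid Q))).
  apply: mu_subset => //; apply/subsetP => A; rewrite !inE => /forall_inP H.
  by apply/forall_inP => i _; apply: H.
apply: le_trans (janson Q p01) _; rewrite ler_expR -/(g Q).
have -> : g Q = \sum_Q' wt Q' * g Q.
  rewrite -mulr_suml; have := mu_setT (X := I) theta.
  rewrite /mu (eq_bigl xpredT) => [->|?]; rewrite ?mul1r//; by rewrite inE.
by apply: ler_sum => Q' _; rewrite ler_wpM2l// Qmin.
Qed.

End Janson.

(** * Passing between graphs and families of two-element sets *)

Section LiftEdges.
Context {Y : finType}.
Implicit Types (F : {set {set Y}}).

Definition lift_edges F : graph Y := [set e : edge Y | val e \in F]%SET.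

Lemma lift_edgesI F F' : lift_edges (F :&: F')%SET = (lift_edges F :&: lift_edges F')%SET.
Proof. by apply/setP => e; rewrite !inE. Qed.

Lemma edges_lift F : (forall e, e \in F -> #|e| = 2%N) -> edges (lift_edges F) = F.
Proof.
move=> F2; apply/setP => e; apply/imsetP/idP => [[x]|eF].
  by rewrite inE => xF ->.
have e2 : #|e| == 2%N by rewrite F2.
by exists (Sub e e2); rewrite ?inE SubK.
Qed.

Lemma card_edges (G : graph Y) : #|edges G| = #|G|.
Proof. by rewrite card_imset//; exact: val_inj. Qed.

Lemma edge_card2 (G : graph Y) e : e \in edges G -> #|e| = 2%N.
Proof. by move=> /imsetP[x _ ->]; apply/eqP/(valP x). Qed.

Lemma edgesS (G G' : graph Y) : (edges G \subset edges G') = (G \subset G').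
Proof.
apply/idP/idP => [/subsetP s|]; last exact: imsetS.
apply/subsetP => e eG; have /imsetP[e' e'G' /val_inj->//] := s _ (imset_f val eG).
Qed.

Lemma card_lift F : (forall e, e \in F -> #|e| = 2%N) -> #|lift_edges F| = #|F|.
Proof. by move=> F2; rewrite -card_edges edges_lift. Qed.

End LiftEdges.

Definition edge_count {V : finType} (E : {set {set V}}) (T : {set V}) : nat :=
  #|[set e in E | e \subset T]%SET|.

Definition image_edges {V Y : finType} (f : V -> Y) (E : {set {set V}}) :
  {set {set Y}} := [set [set f x | x in e]%SET | e : {set V} in E]%SET.

(** * Copies of a bounded graph in a random graph *)

Section RandomCopies.
Context {R : realType} {V Y : finType} {w : nat} (phi : V -> 'I_w -> Y).
Context (S0 : {set V}) (E : {set {set V}}).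
Hypothesis phi_inj : forall u v a b, u \in S0 -> v \in S0 ->
  phi u a = phi v b -> u = v /\ a = b.
Hypothesis E_S0 : forall e, e \in E -> e \subset S0.
Hypothesis E_2 : forall e, e \in E -> #|e| = 2%N.
Hypothesis E_neq0 : (0 < #|E|)%N.
Implicit Types (f g : {ffun V -> 'I_w}).

Let m f v := phi v (f v).

(** Partite copies: [phi v] lists [w] candidate images of [v], with disjoint ranges for distinct [v]
    in [S0]. Taking [f] on all of [V] avoids a dependent domain; each copy is then indexed
    repeatedly, which is harmless since coinciding copies count as overlapping. *)
Definition family_copy f : graph Y := lift_edges (image_edges (m f) E).

Let agree f g := [set v in S0 | f v == g v]%SET.

Lemma m_inj f : {in S0 &, injective (m f)}.
Proof. by move=> u v uS vS /(phi_inj uS vS)[]. Qed.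

(** Disjoint candidate ranges let an image edge remember the edge it came from, so the edges shared
    by two copies are read off from the agreement set alone. *)
Lemma m_imset_eq f g e e' : e \in E -> e' \in E ->
  [set m f x | x in e]%SET = [set m g x | x in e']%SET ->
  e = e' /\ e \subset agree f g.
Proof.
move=> /E_S0/subsetP eS /E_S0/subsetP e'S eq.
have H1 x : x \in e -> x \in e' /\ f x = g x.
  move=> xe; have : m f x \in [set m g x | x in e']%SET by rewrite -eq imset_f.
  move=> /imsetP[y ye' /(phi_inj (eS _ xe) (e'S _ ye'))[xy fg]].
  by rewrite fg xy ye'.
have H2 x : x \in e' -> x \in e.
  move=> xe; have : m g x \in [set m f x | x in e]%SET by rewrite eq imset_f.
  by move=> /imsetP[y ye' /(phi_inj (e'S _ xe) (eS _ ye'))[->]].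
split; first by apply/setP => x; apply/idP/idP => [/H1[]|/H2].
by apply/subsetP => x xe; rewrite inE eS//=; have [_ ->] := H1 _ xe.
Qed.

Lemma image_edges_2 f e : e \in image_edges (m f) E -> #|e| = 2%N.
Proof.
move=> /imsetP[e0 e0E ->]; rewrite card_in_imset ?E_2//.
move=> x y xe ye; apply: m_inj; exact: (subsetP (E_S0 e0E)).
Qed.

Lemma card_image_edges f : #|image_edges (m f) E| = #|E|.
Proof. by rewrite card_in_imset// => e e' eE e'E /(m_imset_eq eE e'E)[]. Qed.

Lemma card_family_copy f : #|family_copy f| = #|E|.
Proof. rewrite card_lift ?card_image_edges//; exact: image_edges_2. Qed.

Lemma card_family_copyI f g :
  #|(family_copy f :&: family_copy g)%SET| = edge_count E (agree f g).
Proof.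
rewrite -lift_edgesI card_lift; last by move=> e /setIP[/image_edges_2].
have -> : (image_edges (m f) E :&: image_edges (m g) E)%SET =
    image_edges (m f) [set e in E | e \subset agree f g].
  apply/setP => e; rewrite inE; apply/andP/imsetP => [[/imsetP[e1 e1E ->]]|[e1]].
    by move=> /imsetP[e2 e2E /(m_imset_eq e1E e2E)[_ s]]; exists e1; rewrite // inE e1E.
  rewrite inE => /andP[e1E /subsetP s] ->; split; first exact: imset_f.
  apply/imsetP; exists e1 => //; apply: eq_in_imset => x /s.
  by rewrite inE /m => /andP[_ /eqP->].
rewrite card_in_imset// => e e'; rewrite !inE => /andP[eE _] /andP[e'E _].
by move=> /(m_imset_eq eE e'E)[].
Qed.

Lemma card_agreeing f (T : {set V}) :
  (#|[set g : {ffun V -> 'I_w} | [forall v in T, f v == g v]]%SET| * w ^ #|T| = w ^ #|V|)%N.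
Proof.
have -> : #|[set g : {ffun V -> 'I_w} | [forall v in T, f v == g v]]%SET| =
   #|family (fun v => if v \in T then pred1 (f v) else predT)|.
  apply: eq_card => g; rewrite inE; apply/forall_inP/familyP => H v.
    by case: ifP => [/H/eqP->|//]; rewrite inE.
  by move=> vT; have := H v; rewrite vT inE eq_sym.
rewrite card_family foldrE big_map big_enum/= (bigID (mem T))/=.
rewrite big1 ?mul1n => [|v ->]; last by rewrite card1.
rewrite (eq_bigr (fun=> w)) => [|v /negbTE->]; last by rewrite card_ord.
rewrite prod_nat_const -expnD -(cardC (mem T)) addnC; congr (w ^ (_ + _))%N.
Qed.

(** Second moment by agreement sets: a pair agreeing exactly on [T] contributes [p ^ (2e - e(T))],
    and each [f] has at most [w ^ (|V| - |T|)] such partners. The hypothesis makes the total for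
    each [T] at most [(M * p ^+ e) ^+ 2 / L], and there are [2 ^ |S0|] sets [T]. *)
Lemma random_copies (p L : R) : 0 <= p <= 1 -> 0 < L ->
  (forall T : {set V}, T \subset S0 -> (0 < edge_count E T)%N ->
     L <= w%:R ^+ #|T| * p ^+ edge_count E T) ->
  mu p (avoid family_copy [set: {ffun V -> 'I_w}]%SET) <= expR (- (L / 2 ^+ (#|S0| + 2))).
Proof.
move=> p01 L0 HL; have [p0 p1] := andP p01.
set e := #|E|; pose M : R := w%:R ^+ #|V|.
have ecE T : (edge_count E T <= e)%N.
  by apply: subset_leq_card; apply/subsetP => x; rewrite inE => /andP[].
have eS0 : edge_count E S0 = e.
  apply: eq_card => x; rewrite inE; apply: andb_idr; exact: E_S0.
have LS0 : L <= w%:R ^+ #|S0| * p ^+ e by rewrite -eS0 HL// eS0.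
have Lp : 0 < w%:R ^+ #|S0| * p ^+ e by exact: lt_le_trans LS0.
have pe0 : 0 < p ^+ e.
  by rewrite lt_neqAle exprn_ge0// andbT; apply: contraTneq Lp => <-; rewrite mulr0 ltxx.
have w0 : (0 < w)%N.
  have [v vS] : exists v, v \in S0.
    have [x xE] := card_gt0P E_neq0.
    have /card_gt0P[v vx] : (0 < #|x|)%N by rewrite E_2.
    by exists v; exact: (subsetP (E_S0 xE)).
  rewrite lt0n; apply: contraTneq Lp => ->.
  by rewrite expr0n (cardsD1 v) vS/= mul0r ltxx.
have w1 : 1 <= w%:R :> R by rewrite ler1n.
have M0 : 0 < M by rewrite exprn_gt0// ltr0n.
have muE : \sum_f p ^+ #|family_copy f| = M * p ^+ e.
  rewrite (eq_bigr (fun=> p ^+ e)) => [|f _]; last by rewrite card_family_copy.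
  by rewrite sumr_const card_ffun card_ord -[LHS]mulr_natl natrX.
have Lmu : L <= M * p ^+ e.
  apply: le_trans LS0 _; rewrite ler_pM2r// ler_weXn2l//; exact: max_card.
have DeltaE : \sum_f \sum_(g | overlap family_copy f g)
    p ^+ #|(family_copy f :|: family_copy g)%SET| <=
    (M * p ^+ e) ^+ 2 * 2 ^+ #|S0| / L.
  have -> : (M * p ^+ e) ^+ 2 * 2 ^+ #|S0| / L =
     \sum_(f : {ffun V -> 'I_w}) \sum_(T in powerset S0) (M * p ^+ (2 * e) / L).
    rewrite (eq_bigr (fun=> 2 ^+ #|S0| * (M * p ^+ (2 * e) / L))) => [|f _]; last first.
      by rewrite sumr_const card_powerset -[LHS]mulr_natl natrX.
    rewrite sumr_const card_ffun card_ord -[RHS]mulr_natl natrX -/M mulnC exprM.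
    have aux (a b c d : R) : (a * b) ^+ 2 * c * d = a * (c * (a * b ^+ 2 * d)) by ring.
    exact: aux.
  apply: ler_sum => f _.
  rewrite (partition_big (agree f) (mem (powerset S0)))/=; last first.
    by move=> g _; rewrite inE; apply/subsetP => v; rewrite inE => /andP[].
  apply: ler_sum => T; rewrite inE => TS0; rewrite ler_pdivlMr//.
  (* Copies that agree on a set spanning no edge of [E] share no edge, hence do not overlap. *)
  have [ecT|ecT] := posnP (edge_count E T).
    rewrite big1 ?mul0r ?mulr_ge0 ?exprn_ge0 ?ler0n// => g /andP[/andP[_ mfg] /eqP aT].
    by move: mfg; rewrite -setI_eq0 -cards_eq0 card_family_copyI aT ecT.
  apply: (@le_trans _ _ ((\sum_(g : {ffun V -> 'I_w} | [forall v in T, f v == g v])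
     p ^+ (2 * e - edge_count E T)) *
     (w%:R ^+ #|T| * p ^+ edge_count E T))).
    apply: ler_pM; rewrite ?sumr_ge0//; first by move=> *; exact: exprn_ge0.
    - exact: ltW.
    - rewrite [leLHS]big_mkcond [leRHS]big_mkcond/=; apply: ler_sum => g _.
      case: ifP => [/andP[_ /eqP aT]|_]; last by case: ifP; rewrite ?exprn_ge0.
      rewrite ifT; last by rewrite -aT; apply/forall_inP => v; rewrite inE => /andP[].
      by rewrite cardsU !card_family_copy card_family_copyI aT mul2n addnn.
    - exact: HL.
  rewrite sumr_const -[_ *+ #|_|]mulr_natl mulrACA -exprD subnK; last first.
    by rewrite (leq_trans (ecE T))// leq_pmull.
  rewrite ler_wpM2r ?exprn_ge0// -natrX -natrM /M -natrX ler_nat.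
  by rewrite -(card_agreeing f T) leq_mul2r; apply/orP; right; rewrite cardsE.
pose mu0 := M * p ^+ e.
have mu00 : 0 < mu0 by rewrite mulr_gt0.
have k0 : 0 < 2 ^+ #|S0| :> R by rewrite exprn_gt0.
have k1 : 1 <= 2 ^+ #|S0| :> R by rewrite exprn_ege1// ler1n.
(* The minimiser of the quadratic exponent in [theta]; it is at most 1 by [Lmu], and the minimum
   [- L / (4 * 2 ^ |S0|)] explains the [+ 2] in the conclusion. *)
pose theta := L / (2 * 2 ^+ #|S0| * mu0).
have th0 : 0 <= theta by rewrite divr_ge0 ?mulr_ge0 ?ltW.
have th1 : theta <= 1.
  rewrite ler_pdivrMr ?mulr_gt0// mul1r; apply: le_trans Lmu _.
  apply: ler_peMl; first exact: ltW.
  by apply: le_trans k1 _; apply: ler_peMl; rewrite ?ler1n// ltW.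
apply: le_trans (@janson_sparse _ _ _ family_copy p theta p01 _) _; first by rewrite th0.
rewrite ler_expR muE -/mu0.
apply: (@le_trans _ _ (theta ^+ 2 * (mu0 ^+ 2 * 2 ^+ #|S0| / L) - theta * mu0)).
  by rewrite lerD2r ler_wpM2l// exprn_ge0.
rewrite /theta exprD le_eqVlt; apply/orP; left; apply/eqP; field.
by rewrite !gt_eqF.
Qed.

End RandomCopies.

(** * Greedy embedding *)

Lemma extend_injection {V Y : finType} (N : {set V}) (f : V -> Y) :
  (#|V| <= #|Y|)%N -> {in N &, injective f} ->
  exists2 g : V -> Y, injective g & {in N, g =1 f}.
Proof.
move=> leVY finj.
have [V0|/card_gt0P[v0 _]] := posnP #|V|.
  exists f => // x; by have := card0_eq V0 x; rewrite inE.
pose W := (~: [set f x | x in N])%SET.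
pose h x := nth (f v0) (enum W) (index x (enum (~: N)%SET)).
have ltW x : x \notin N -> (index x (enum (~: N)%SET) < size (enum W))%N.
  move=> xN; apply: (@leq_trans #|(~: N)%SET|).
    by rewrite cardE index_mem mem_enum inE.
  by rewrite -cardE (cardsCs (~: N)%SET) (cardsCs W) !setCK card_in_imset// leq_sub2r.
have hW x : x \notin N -> h x \in W.
  by move=> xN; rewrite -mem_enum mem_nth// ltW.
exists (fun x => if x \in N then f x else h x) => [x y|x ->//].
case: ifPn => xN; case: ifPn => yN.
- exact: finj.
- by move=> e; have := hW _ yN; rewrite -e inE imset_f.
- by move=> e; have := hW _ xN; rewrite e inE imset_f.
- move=> /eqP; rewrite nth_uniq ?ltW ?enum_uniq// => /eqP.
  by apply: index_inj; rewrite ?mem_enum ?inE.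
Qed.

Definition fiber {V : finType} {T : eqType} (N : {set V}) (comp : V -> T) (t : V) :=
  [set x in N | comp x == comp t]%SET.

Definition edges_in {V : finType} (A : graph V) (S : {set V}) :=
  [set e in edges A | e \subset S]%SET.

(** The images used so far number at most [|N|], so at least [|~: N|] vertices of [Y] remain free
    and the same step hypothesis serves throughout. Vertices outside [N] are isolated and are placed
    last, by [extend_injection]. *)
Lemma greedy_embedding {V Y : finType} {T : eqType} (A : graph V) (G : graph Y)
    (N : {set V}) (comp : V -> T) : (#|V| <= #|Y|)%N ->
  (forall e, e \in edges A -> e \subset N) ->
  (forall e x y, e \in edges A -> x \in e -> y \in e -> comp x = comp y) ->
  (forall t (W : {set Y}), (#|(~: N)%SET| <= #|W|)%N -> exists g : V -> Y,
    [/\ {in fiber N comp t &, injective g}, {in fiber N comp t, forall x, g x \in W} &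
      image_edges g (edges_in A (fiber N comp t)) \subset edges G]) ->
  has_copy A G.
Proof.
move=> leVY AN Acomp step.
pose U s := [set x in N | has (fun t => comp x == comp t) s]%SET.
suff H s : exists2 f : V -> Y, {in U s &, injective f} &
    image_edges f (edges_in A (U s)) \subset edges G.
  have [f finj fG] := H (enum V).
  have UN : U (enum V) = N.
    apply/setP => x; rewrite inE; apply: andb_idr => _.
    by apply/hasP; exists x; rewrite ?mem_enum.
  rewrite UN in finj fG; have [g ginj gf] := extend_injection leVY finj.
  exists g; split => //; apply/subsetP => e' /imsetP[e eA ->].
  apply: (subsetP fG); apply/imsetP; exists e; first by rewrite inE eA AN.
  apply: eq_in_imset => x xe; exact/gf/(subsetP (AN _ eA)).
elim: s => [|t s [f finj fG]].
  have [V0|/card_gt0P[v0 _]] := posnP #|V|.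
    have nV (x : V) : False by have := card0_eq V0 x.
    have [f] : exists f : V -> Y, True by exists (fun x => False_rect _ (nV x)).
    exists f => [x|]; first by case: (nV x).
    apply/subsetP => e' /imsetP[e]; rewrite inE => /andP[/edge_card2 e2 _].
    by have /card_gt0P[x] : (0 < #|e|)%N; [rewrite e2|case: (nV x)].
  have /card_gt0P[y0 _] : (0 < #|Y|)%N by apply: leq_trans leVY; apply/card_gt0P; exists v0.
  exists (fun=> y0) => [x|]; first by rewrite inE andbF.
  apply/subsetP => e' /imsetP[e]; rewrite inE => /andP[/edge_card2 e2 /subsetP s].
  have /card_gt0P[x] : (0 < #|e|)%N by rewrite e2.
  by move=> /s; rewrite inE andbF.
(* The list runs over vertices, not classes; a class met before is already embedded. *)
have [ts|ts] := boolP (has (fun u => comp t == comp u) s).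
  suff -> : U (t :: s) = U s by exists f.
  apply/setP => x; rewrite !inE/=; congr (_ && _).
  by apply: orb_idl => /eqP->.
pose W := (~: [set f x | x in U s])%SET.
have leW : (#|(~: N)%SET| <= #|W|)%N.
  rewrite (cardsCs (~: N)%SET) (cardsCs W) !setCK card_in_imset// leq_sub// subset_leq_card//.
  by apply/subsetP => x; rewrite inE => /andP[].
have [g [ginj gW gG]] := step t W leW.
pose f' x := if comp x == comp t then g x else f x.
have Ut x : x \in U (t :: s) -> comp x == comp t -> x \in fiber N comp t.
  by rewrite !inE => /andP[-> _] ->.
have Us x : x \in U (t :: s) -> comp x != comp t -> x \in U s.
  by rewrite !inE/= => /andP[-> /orP[->|]].
exists f' => [x y xU yU|].
  rewrite /f'; case: ifPn => xt; case: ifPn => yt.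
  - by apply: ginj; exact: Ut.
  - by move=> e; have := gW _ (Ut _ xU xt); rewrite e inE imset_f// Us.
  - by move=> e; have := gW _ (Ut _ yU yt); rewrite -e inE imset_f// Us.
  - by apply: finj; exact: Us.
apply/subsetP => e' /imsetP[e]; rewrite inE => /andP[eA /subsetP eU] ->.
have /card_gt0P[x xe] : (0 < #|e|)%N by rewrite (edge_card2 eA).
have [xt|xt] := boolP (comp x == comp t).
  have -> : [set f' x | x in e]%SET = [set g x | x in e]%SET.
    by apply: eq_in_imset => y ye; rewrite /f' (Acomp _ _ _ eA ye xe) xt.
  apply: (subsetP gG); apply: imset_f; rewrite inE eA; apply/subsetP => y ye.
  by apply: Ut; rewrite ?eU// (Acomp _ _ _ eA ye xe).
have -> : [set f' x | x in e]%SET = [set f x | x in e]%SET.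
  by apply: eq_in_imset => y ye; rewrite /f' (Acomp _ _ _ eA ye xe) (negbTE xt).
apply: (subsetP fG); apply: imset_f; rewrite inE eA; apply/subsetP => y ye.
by apply: Us; rewrite ?eU// (Acomp _ _ _ eA ye xe).
Qed.

(** [comp] labels classes that are unions of components. Multiplied by [|V|], the last clause says
    that, up to constants, each piece of a class has at least [c * |V|] expected copies. *)
Definition scattered {R : realType} {V : finType} {T : eqType} (k M : nat) (c p : R)
    (A : graph V) (N : {set V}) (comp : V -> T) : Prop :=
  [/\ (#|V| <= M * #|(~: N)%SET|)%N,
      forall e, e \in edges A -> e \subset N,
      forall e x y, e \in edges A -> x \in e -> y \in e -> comp x = comp y,
      forall t, (#|fiber N comp t| <= k)%N
    & forall S : {set V}, S \subset N -> {in S &, forall x y, comp x = comp y} ->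
        (0 < edge_count (edges A) S)%N ->
        c <= p ^+ edge_count (edges A) S * #|V|%:R ^+ #|S|.-1].

(** Solves [L / 2 ^ (k + 2) >= 15 * n] for [L = n * C * c / (2 * M * k) ^ k], the bound fed to
    [random_copies]; the summand 1 gives [C >= 1]. *)
Definition boost {R : realType} (k M : nat) (c : R) : R :=
  1 + 15 * (2 ^+ (k + 2) * (2 * M * k)%:R ^+ k / c).

Lemma boost_ge1 {R : realType} (k M : nat) (c : R) : 0 < c -> 1 <= boost k M c.
Proof.
by move=> c0; rewrite lerDl mulr_ge0// divr_ge0 ?mulr_ge0 ?exprn_ge0 ?ler0n ?ltW.
Qed.

(** Only [1 + 15 <= e ^ 15] is used; 16 is the square of 4, so a union bound over [4 ^ n] events
    leaves [4 ^- n]. *)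
Lemma expR_le_inv16 {R : realType} (n : nat) : expR (- (15 * n%:R)) <= 16^-1 ^+ n :> R.
Proof.
rewrite -mulNr expRM_natr expRN; apply: lerXn2r; rewrite ?nnegrE ?invr_ge0 ?expR_ge0//.
rewrite lef_pV2 ?posrE ?expR_gt0//; apply: le_trans (expR_ge1Dx _); lra.
Qed.

Lemma scattered_appears {R : realType} {V : finType} {T : eqType} (k M : nat)
    (c p : R) (A : graph V) (N : {set V}) (comp : V -> T) :
  (0 < k)%N -> (0 < M)%N -> 0 < c -> 0 <= p -> boost k M c * p <= 1 ->
  (1 < #|V|)%N -> (M * k <= #|V|)%N -> scattered k M c p A N comp ->
  3 / 4 < mu (boost k M c * p) (I_ #|V| A).
Proof.
move=> k0 M0 c0 p0 Cp1 n2 Mkn [NM AN Acomp fk cS].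
set n := #|V|; set C := boost k M c; set q := C * p.
have C1 : 1 <= C by exact: boost_ge1.
have n0 : (0 < n)%N by exact: ltnW.
have C0 : 0 < C by exact: lt_le_trans C1.
have C0' : 0 <= C by exact: ltW.
have q0 : 0 <= q by rewrite mulr_ge0.
have q01 : 0 <= q <= 1 by rewrite q0.
(* A set of at least [n / M] free vertices contains [k] disjoint blocks of [w] candidates; [phi]
   gives each vertex of a class the block numbered by its rank in the class. *)
pose w := (n %/ (M * k))%N.
have w0 : (0 < w)%N by rewrite divn_gt0 ?muln_gt0 ?M0.
have nw : (n <= 2 * M * k * w)%N.
  have := ltn_ceil n (_ : 0 < M * k)%N; rewrite muln_gt0 M0 k0 => /(_ isT).
  by rewrite -/w; nia.
have kwM : (k * w * M <= n)%N.
  by have := leq_trunc_div n (M * k); rewrite -/w; nia.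
pose fb := fiber N comp.
pose y0 : 'I_n := Ordinal (ltnW n2).
pose phi (W : {set 'I_n}) t v (b : 'I_w) :=
  nth y0 (enum W) (index v (enum (fb t)) * w + b).
have phi_lt (W : {set 'I_n}) t v (b : 'I_w) : (k * w <= #|W|)%N -> v \in fb t ->
    (index v (enum (fb t)) * w + b < size (enum W))%N.
  move=> kW vt; rewrite -cardE (leq_trans _ kW)//.
  have lt : (index v (enum (fb t)) < k)%N.
    by apply: leq_trans (fk t); rewrite cardE index_mem mem_enum.
  rewrite -addnS (leq_trans (leq_add (leqnn _) (ltn_ord b)))// -mulSnr.
  by rewrite leq_mul2r lt orbT.
have phi_W (W : {set 'I_n}) t v b : (k * w <= #|W|)%N -> v \in fb t -> phi W t v b \in W.
  by move=> kW vt; rewrite -mem_enum mem_nth ?phi_lt.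
have phi_inj (W : {set 'I_n}) t u v (a b : 'I_w) : (k * w <= #|W|)%N ->
    u \in fb t -> v \in fb t -> phi W t u a = phi W t v b -> u = v /\ a = b.
  move=> kW ut vt /eqP; rewrite nth_uniq ?phi_lt ?enum_uniq// => /eqP e.
  have ab : a = b.
    apply: val_inj; have := congr1 (modn^~ w) e.
    by rewrite !modnMDl !modn_small.
  split=> //; move: e; rewrite ab => /addIn/eqP; rewrite eqn_pmul2r// => /eqP.
  by apply: index_inj; rewrite ?mem_enum.
pose E t := edges_in A (fb t).
have E_sub t e : e \in E t -> e \subset fb t by rewrite inE => /andP[].
have E_2 t e : e \in E t -> #|e| = 2%N by rewrite inE => /andP[/edge_card2].
(* The free set met by the greedy embedding depends on the random graph, so the union bound runs
   over every [W] that is large enough. *)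
pose bad (tW : V * {set 'I_n}) : {set graph 'I_n} :=
  avoid (family_copy (phi tW.2 tW.1) (E tW.1)) [set: {ffun V -> 'I_w}]%SET.
pose P (tW : V * {set 'I_n}) := (0 < #|E tW.1|)%N && (n <= M * #|tW.2|)%N.
have kW (W : {set 'I_n}) : (n <= M * #|W|)%N -> (k * w <= #|W|)%N.
  by move=> nMW; rewrite -(leq_pmul2r M0) (leq_trans kwM)// mulnC.
have bad_small tW : P tW -> mu q (bad tW) <= 16^-1 ^+ n.
  case: tW => t W /andP[/= Et /kW kwW].
  pose K : R := (2 * M * k)%:R.
  have K1 : 1 <= K by rewrite ler1n !muln_gt0 M0 k0.
  have K0 : 0 < K by exact: lt_le_trans K1.
  pose L : R := n%:R * C * c / K ^+ k.
  have L0 : 0 < L.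
    by rewrite divr_gt0 ?exprn_gt0// !mulr_gt0 ?ltr0n.
  apply: le_trans (@random_copies _ _ _ _ _ (fb t) _ _ _ _ _ q L q01 L0 _) _ => //.
  - by move=> u v a b; apply: (@phi_inj W t u v a b kwW).
  - exact: E_sub.
  - exact: E_2.
  - move=> S St ecS.
    have ecE : edge_count (E t) S = edge_count (edges A) S.
      apply: eq_card => e; rewrite !inE; case eS: (e \subset S); rewrite ?andbF// !andbT.
      by rewrite (subset_trans eS St) andbT.
    rewrite ecE in ecS *; set ec := edge_count _ _ in ecS *.
    have SN : S \subset N.
      by apply: subset_trans St _; apply/subsetP => x; rewrite inE => /andP[].
    have Scomp : {in S &, forall x y, comp x = comp y}.
      move=> x y /(subsetP St); rewrite inE => /andP[_ /eqP->].
      by move=> /(subsetP St); rewrite inE => /andP[_ /eqP->].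
    have S0 : (0 < #|S|)%N.
      have /card_gt0P[e] := ecS; rewrite inE => /andP[/edge_card2 e2].
      by move=> /subset_leq_card; rewrite e2; apply: ltn_trans.
    have Sk : (#|S| <= k)%N by apply: leq_trans (fk t); exact: subset_leq_card.
    have cle := cS S SN Scomp ecS.
    rewrite ler_pdivrMr ?exprn_gt0//.
    have h1 : n%:R ^+ #|S| <= K ^+ k * w%:R ^+ #|S| :> R.
      apply: (@le_trans _ _ (K ^+ #|S| * w%:R ^+ #|S|)).
        rewrite -exprMn; apply: lerXn2r; by rewrite ?nnegrE ?mulr_ge0 ?ler0n// -natrM ler_nat.
      by rewrite ler_wpM2r ?exprn_ge0// ler_weXn2l.
    (* As [S] spans an edge and [C >= 1], at least one full factor [C] is gained. *)
    have h2 : C * p ^+ ec <= q ^+ ec.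
      by rewrite /q exprMn ler_wpM2r ?exprn_ge0// -[leLHS]expr1 ler_weXn2l.
    apply: (@le_trans _ _ (n%:R * C * (p ^+ ec * n%:R ^+ #|S|.-1))).
      by rewrite ler_wpM2l// mulr_ge0 ?ler0n.
    have -> : n%:R * C * (p ^+ ec * n%:R ^+ #|S|.-1) = n%:R ^+ #|S| * (C * p ^+ ec) :> R.
      by rewrite -[in RHS](prednK S0) exprS [p ^+ ec * _]mulrC mulrACA.
    have -> : w%:R ^+ #|S| * q ^+ ec * K ^+ k = (K ^+ k * w%:R ^+ #|S|) * q ^+ ec.
      by rewrite mulrAC [w%:R ^+ _ * _]mulrC.
    by apply: ler_pM => //; rewrite mulr_ge0 ?exprn_ge0.
  - apply: le_trans (expR_le_inv16 n); rewrite ler_expR lerN2.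
    rewrite ler_pdivlMr ?exprn_gt0//.
    apply: (@le_trans _ _ (15 * n%:R * 2 ^+ (k + 2))).
      rewrite ler_wpM2l ?mulr_ge0 ?ler0n// ler_weXn2l ?ler1n// leq_add2r; exact: fk.
    rewrite ler_pdivlMr ?exprn_gt0//.
    have Kk0 : 0 < K ^+ k by rewrite exprn_gt0.
    have -> : 15 * n%:R * 2 ^+ (k + 2) * K ^+ k =
        n%:R * (15 * (2 ^+ (k + 2) * K ^+ k / c)) * c.
      by move: (2 ^+ (k + 2)) (K ^+ k) => a b; field; rewrite gt_eqF.
    by rewrite ler_wpM2r ?(ltW c0)// ler_wpM2l ?ler0n// lerDr.
pose Bad := (\bigcup_(tW | P tW) bad tW)%SET.
have BadS : mu q Bad < 1 / 4.
  apply: le_lt_trans (mu_bigcup _ _ q01) _.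
  apply: (@le_lt_trans _ _ (\sum_(tW : V * {set 'I_n}) 16^-1 ^+ n)).
    rewrite big_mkcond/=; apply: ler_sum => tW _; case: ifP => [/bad_small//|_].
    by rewrite exprn_ge0// invr_ge0.
  have n4 : (#|{: V * {set 'I_n}}| <= 4 ^ n)%N.
    have card2n : #|{: {set 'I_n}}| = (2 ^ n)%N.
      by rewrite -cardsT -powersetT card_powerset cardsT card_ord.
    rewrite card_prod card2n -/n -[4%N]/(2 * 2)%N expnMn leq_mul2r.
    by rewrite ltnW ?orbT// ltn_expl.
  rewrite sumr_const -[ltLHS]mulr_natl.
  apply: (@le_lt_trans _ _ ((4 ^ n)%:R * 16^-1 ^+ n)).
    by rewrite ler_wpM2r ?exprn_ge0 ?invr_ge0// ler_nat.
  rewrite natrX -exprMn (_ : 4%:R / 16 = 1 / 4 :> R); last by lra.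
  (* Strict because [n > 1]; the strictness carries over to the pigeonhole on permutations. *)
  by rewrite -[ltRHS]expr1 ltr_iXn2l// ; lra.
have sub : (~: Bad)%SET \subset I_ n A.
  apply/subsetP => G; rewrite !inE => /bigcupP nB; apply/asboolP.
  apply: (@greedy_embedding _ _ _ A G N comp) => // [|t W leW]; first by rewrite card_ord.
  have nMW : (n <= M * #|W|)%N by apply: leq_trans NM _; rewrite leq_pmul2l.
  have kwW := kW _ nMW.
  have [E0|E0] := posnP #|E t|.
    exists (fun v => phi W t v (Ordinal w0)); split.
    - by move=> u v ut vt /(phi_inj _ _ _ _ _ _ kwW ut vt)[].
    - by move=> v vt; exact: phi_W.
    - apply/subsetP => e /imsetP[e']; rewrite -/(fb t) -/(E t).
      by rewrite (cards0_eq E0) inE.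
  have /existsP[f sG] : [exists f : {ffun V -> 'I_w}, family_copy (phi W t) (E t) f \subset G].
    apply/contraT; rewrite negb_exists => /forallP nf; exfalso; apply: nB.
    exists (t, W); first by rewrite /P/= E0.
    by rewrite inE; apply/forall_inP => f _; exact: nf.
  exists (fun v => phi W t v (f v)); split.
  - by move=> u v ut vt /(phi_inj _ _ _ _ _ _ kwW ut vt)[].
  - by move=> v vt; exact: phi_W.
  - move: sG; rewrite -edgesS edges_lift// => e.
    apply: image_edges_2 => //; [|exact: E_sub|exact: E_2].
    by move=> u v a b; apply: (@phi_inj W t u v a b kwW).
apply: lt_le_trans (mu_subset q01 sub); rewrite mu_setC; lra.
Qed.

(** * Random placements *)

Section Relabel.
Implicit Types (V Y Z : finType).

Definition relabel {V Y} (f : V -> Y) (G : graph V) : graph Y :=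
  lift_edges (image_edges f (edges G)).

Lemma edges_relabel {V Y} (f : V -> Y) (G : graph V) : injective f ->
  edges (relabel f G) = image_edges f (edges G).
Proof.
move=> finj; apply: edges_lift => e /imsetP[e' e'G ->].
by rewrite card_imset// (edge_card2 e'G).
Qed.

Lemma card_image_edges_inj {V Y} (f : V -> Y) (E : {set {set V}}) : injective f ->
  #|image_edges f E| = #|E|.
Proof. by move=> finj; rewrite card_imset//; exact: imset_inj. Qed.

Lemma card_relabel {V Y} (f : V -> Y) (G : graph V) : injective f -> #|relabel f G| = #|G|.
Proof.
by move=> finj; rewrite -card_edges edges_relabel// card_image_edges_inj// card_edges.
Qed.

Lemma relabelS {V Y} (f : V -> Y) (G G' : graph V) : injective f ->
  G \subset G' -> relabel f G \subset relabel f G'.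
Proof. by move=> finj s; rewrite -edgesS !edges_relabel// imsetS// edgesS. Qed.

Lemma relabelU {V Y} (f : V -> Y) (G G' : graph V) : injective f ->
  relabel f (G :|: G')%SET = (relabel f G :|: relabel f G')%SET.
Proof.
by move=> finj; apply/setP => e; rewrite !inE /image_edges /edges !imsetU inE.
Qed.

Lemma relabel_comp {V Y Z} (f : V -> Y) (g : Y -> Z) (G : graph V) : injective f ->
  relabel g (relabel f G) = relabel (g \o f) G.
Proof.
move=> finj; congr lift_edges; rewrite edges_relabel// /image_edges -imset_comp.
by apply: eq_imset => e /=; rewrite -imset_comp.
Qed.

Lemma eq_relabel {V Y} (f g : V -> Y) (G : graph V) : f =1 g -> relabel f G = relabel g G.
Proof.
by move=> fg; congr lift_edges; apply: eq_imset => e; apply: eq_imset.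
Qed.

Lemma relabel_id {V} (G : graph V) : relabel id G = G.
Proof.
apply/setP => e; rewrite inE /image_edges (eq_imset _ (@imset_id _)) imset_id.
by rewrite mem_imset//; exact: val_inj.
Qed.

Lemma has_copy_relabel {V Y} (H : graph V) (G : graph Y) :
  has_copy H G <-> exists2 f : V -> Y, injective f & relabel f H \subset G.
Proof.
split=> -[f]; first by case=> finj s; exists f => //; rewrite -edgesS edges_relabel.
by move=> finj s; exists f; split=> //; rewrite -edgesS edges_relabel in s.
Qed.

End Relabel.

(** * Averaging over permutations of the vertices *)

Section Symmetrization.
Context {R : realType} {V : finType}.
Let n := #|V|.
Implicit Types (p : R) (A B H : graph V) (D : {set graph 'I_n}) (s : {perm 'I_n}).

Lemma mu_relabel p D s : mu p [set G : graph 'I_n | relabel s G \in D]%SET = mu p D.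
Proof.
have bij : {on [pred G | G \in D], bijective (@relabel 'I_n 'I_n s)}.
  apply: onW_bij; exists (relabel s^-1%g) => G;
    rewrite relabel_comp; [|exact: perm_inj| |exact: perm_inj];
    rewrite -[RHS]relabel_id; apply: eq_relabel => x /=; [exact: permK|exact: permKV].
rewrite [RHS]/mu (reindex _ bij)/=; apply: eq_big => [G|G _]; first by rewrite inE.
have cs := card_relabel G (@perm_inj _ s).
by rewrite cs (cardsCs (~: relabel s G)%SET) (cardsCs (~: G)%SET) !setCK cs.
Qed.

(** Fixing [enum_rank] indexes the bijections from [V] to ['I_n] by a group, so averaging over
    placements becomes translation in that group. *)
Definition placement (s : {perm 'I_n}) : V -> 'I_n := s \o @enum_rank V.

Lemma placement_inj s : injective (placement s).
Proof. apply: inj_comp; [exact: perm_inj|exact: enum_rank_inj]. Qed.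

(* If [G] contains a copy of [A] then the relabelling of [G] by a random
   permutation contains a uniformly random copy of [A]. *)
Lemma placements_in p D A : 0 <= p <= 1 -> decreasing D ->
  3 / 4 <= mu p D -> 3 / 4 < mu p (I_ n A) ->
  (#|{perm 'I_n}| < 2 * #|[set s | relabel (placement s) A \in D]%SET|)%N.
Proof.
move=> p01 Ddec muD muA; have [p0 p1] := andP p01.
set K := #|[set s | _]%SET|.
pose wt (G : graph 'I_n) : R := p ^+ #|G| * (1 - p) ^+ #|(~: G)%SET|.
have wt0 G : 0 <= wt G by rewrite mulr_ge0 ?exprn_ge0 ?subr_ge0.
pose F s := ([set G : graph 'I_n | relabel s G \in D] :&: I_ n A)%SET.
have lowF s : 1 / 2 < mu p (F s).
  have := muID p (I_ n A) [set G : graph 'I_n | relabel s G \in D]%SET.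
  rewrite setIC -/(F s).
  have : mu p (I_ n A :\: [set G : graph 'I_n | relabel s G \in D])%SET <= 1 - mu p D.
    rewrite -(mu_relabel p D s) -mu_setC; apply: mu_subset => //.
    by rewrite setDE subsetIr.
  lra.
have upG G : G \in I_ n A -> (#|[set s : {perm 'I_n} | relabel s G \in D]%SET| <= K)%N.
  rewrite inE => /asboolP/has_copy_relabel[f finj sG].
  have tinj : injective (f \o @enum_val V predT).
    by apply: inj_comp finj _; exact: enum_val_inj.
  pose t := perm tinj.
  (* If [f] embeds [A] in [G], then [s |-> t * s] injects the permutations sending [G] into [D] into
     those placing [A] in [D], as [D] is decreasing. *)
  rewrite -(card_imset _ (mulgI t)); apply: subset_leq_card.
  apply/subsetP => _ /imsetP[s + ->]; rewrite !inE; apply: Ddec.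
  apply: subset_trans (relabelS (@perm_inj _ s) sG).
  rewrite relabel_comp// (eq_relabel _ (g := s \o f)) ?subxx// => x.
  by rewrite /placement /= permM permE/= enum_rankK.
have : \sum_s mu p (F s) <= K%:R.
  rewrite /mu (eq_bigr (fun s => \sum_(G in I_ n A)
    if relabel s G \in D then wt G else 0)); last first.
    move=> s _; rewrite -big_mkcondr/=; apply: eq_bigl => G.
    by rewrite in_setI [G \in [set _ | _]%SET]inE andbC.
  rewrite exchange_big/=; apply: (@le_trans _ _ (\sum_(G in I_ n A) wt G * K%:R)).
    apply: ler_sum => G GA; rewrite -big_mkcond/= sumr_const -[leLHS]mulr_natr.
    by rewrite ler_wpM2l// ler_nat (leq_trans _ (upG G GA))// cardsE.
  rewrite -mulr_suml ler_piMl ?ler0n// -(@mu_setT _ (edge 'I_n) p).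
  by apply: mu_subset => //; exact: subsetT.
move=> H1; rewrite -(ltr_nat R) natrM.
have H2 : #|{perm 'I_n}|%:R * (1 / 2) < \sum_s mu p (F s).
  have -> : #|{perm 'I_n}|%:R * (1 / 2) = \sum_(s : {perm 'I_n}) (1 / 2 : R).
    by rewrite mulr_natl sumr_const.
  apply: ltr_sum => [|s _]; last exact: lowF.
  by apply/hasP; exists 1%g; rewrite ?mem_index_enum.
lra.
Qed.

(** Each half is in [D] for more than half of the permutations, so some [s] serves both. It must be
    the same [s]: only then is the union of the two placed halves a placed copy of [A :|: B]. *)
Lemma threshold_le p H A B : 0 <= p <= 1 -> H \subset (A :|: B)%SET ->
  3 / 4 < mu p (I_ n A) -> 3 / 4 < mu p (I_ n B) -> p_ 2 n H <= p.
Proof.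
move=> p01 sH muA muB; apply: ge_inf.
  by exists 0 => x [/andP[]].
split=> // D Ddec muD.
have {}muD : 3 / 4 <= mu p D by move: muD; lra.
have KA := placements_in p01 Ddec muD muA.
have KB := placements_in p01 Ddec muD muB.
have [s sA sB] : exists2 s, relabel (placement s) A \in D & relabel (placement s) B \in D.
  set SA := [set s | _]%SET in KA; set SB := [set s | _]%SET in KB.
  have /card_gt0P[s] : (0 < #|SA :&: SB|)%N.
    have leU : (#|(SA :|: SB)%SET| <= #|{perm 'I_n}|)%N by exact: max_card.
    have := cardsUI SA SB; move: KA KB leU.
    move: #|{perm 'I_n}| #|SA| #|SB| #|(SA :|: SB)%SET| #|(SA :&: SB)%SET|; lia.
  by rewrite !inE => /andP[]; exists s.
apply/set0Pn; exists (relabel (placement s) A :|: relabel (placement s) B)%SET.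
rewrite inE; apply/andP; split.
  pose f : {ffun 'I_2 -> graph 'I_n} :=
    [ffun i => if i == ord0 then relabel (placement s) A else relabel (placement s) B].
  apply/imsetP; exists f; last by rewrite big_ord_recl big_ord1 !ffunE.
  by apply/ffun_onP => i; rewrite ffunE; case: ifP.
rewrite inE; apply/asboolP/has_copy_relabel; exists (placement s); first exact: placement_inj.
by rewrite -relabelU ?relabelS//; exact: placement_inj.
Qed.

(** At [p = 1] the random graph is complete. This settles the case where the boosted probability
    exceeds 1. *)
Lemma threshold_le1 H : p_ 2 n H <= 1 :> R.
Proof.
have H1 : 3 / 4 < mu (1 : R) (I_ n H).
  have : mu (1 : R) (up (relabel (placement 1%g) H)) <= mu 1 (I_ n H).
    apply: mu_subset; first by rewrite ler01 lexx.
    apply/subsetP => G; rewrite !inE => s; apply/asboolP/has_copy_relabel.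
    by exists (placement 1%g) => //; exact: placement_inj.
  rewrite mu_up expr1n; apply: lt_le_trans; lra.
apply: (@threshold_le 1 H H H) => //; first by rewrite ler01 lexx.
by rewrite setUid.
Qed.

Lemma q_ge0 H : 0 <= q_ n H :> R.
Proof.
rewrite /q_ /expectation_threshold; set E := (X in sup X).
have [->|/set0P[x Ex]] := eqVneq E classical_sets.set0; first by rewrite sup0.
apply: (@le_trans _ _ x); first by case: Ex => /andP[].
by apply: ub_le_sup => //; exists 1 => y [/andP[]].
Qed.

Definition embeddable_half (k M : nat) (c p : R) (A : graph V) : Prop :=
  exists (T : eqType) (N : {set V}) (comp : V -> T), scattered k M c p A N comp.

Lemma threshold_bound (k M : nat) (c : R) H :
  (0 < k)%N -> (0 < M)%N -> 0 < c -> (1 < n)%N -> (M * k <= n)%N ->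
  (forall p : R, 0 <= p <= 1 -> ~ p_small p (I_ n H) -> exists A B : graph V,
     [/\ H \subset (A :|: B)%SET, embeddable_half k M c p A & embeddable_half k M c p B]) ->
  p_ 2 n H <= boost k M c * q_ n H.
Proof.
move=> k0 M0 c0 n1 Mkn split; set C := boost k M c.
have C1 : 1 <= C by exact: boost_ge1.
have C0 : 0 < C by exact: lt_le_trans C1.
apply/ler_addgt0Pr => e e0.
pose p := q_ n H + e / C.
have -> : C * q_ n H + e = C * p by rewrite mulrDr mulrCA divff ?gt_eqF// mulr1.
have [Cp|Cp] := leP (C * p) 1; last by apply: le_trans (threshold_le1 H) (ltW Cp).
have qp : q_ n H < p by rewrite ltrDl divr_gt0.
have p0 : 0 <= p by rewrite (le_trans (q_ge0 H))// ltW.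
have p01 : 0 <= p <= 1 by rewrite p0 (le_trans _ Cp)// ler_peMl.
have nsmall : ~ p_small p (I_ n H).
  move=> small; move: qp; rewrite ltNge => /negP; apply.
  by apply: ub_le_sup => //; exists 1 => y [/andP[]].
have [A [B [sH [TA [NA [cA hA]]] [TB [NB [cB hB]]]]]] := split p p01 nsmall.
apply: (threshold_le _ sH).
- by rewrite mulr_ge0// ltW.
- exact: scattered_appears hA.
- exact: scattered_appears hB.
Qed.

End Symmetrization.

(** * Lower bounds on the expectation threshold *)

Lemma p_small_cover {R : realType} {X : finType} (p : R) (I G : {set {set X}}) (m K : nat) :
  0 <= p <= 1 -> I \subset (\bigcup_(S in G) up S)%SET ->
  (forall S, S \in G -> (m <= #|S|)%N) -> (#|G| <= K)%N ->
  K%:R * p ^+ m <= 1 / 2 -> p_small p I.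
Proof.
move=> /andP[p0 p1] IG Gm GK small; exists G; split=> //.
apply: le_trans small; apply: (@le_trans _ _ (\sum_(S in G) p ^+ m)).
  by apply: ler_sum => S SG; rewrite mu_up ler_wiXn2l// Gm.
by rewrite sumr_const -[leLHS]mulr_natl ler_wpM2r ?exprn_ge0// ler_nat.
Qed.

Lemma p_small_copies {R : realType} {V : finType} (H : graph V) (p : R) (m : nat) :
  0 <= p <= 1 -> (m <= #|H|)%N -> (#|V| ^ #|V|)%:R * p ^+ m <= 1 / 2 ->
  p_small p (I_ #|V| H).
Proof.
move=> p01 mH small.
pose G := [set relabel f H | f : {ffun V -> 'I_#|V|}
  in [pred f : {ffun V -> 'I_#|V|} | injectiveb f]]%SET.
apply: (@p_small_cover _ _ p _ G m (#|V| ^ #|V|)) => //.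
- apply/subsetP => A; rewrite inE => /asboolP/has_copy_relabel[f finj sA].
  apply/bigcupP; exists (relabel f H); last by rewrite inE.
  apply/imsetP; exists [ffun x => f x].
    by apply/injectiveP => x y; rewrite !ffunE; exact: finj.
  by apply: eq_relabel => x; rewrite ffunE.
- by move=> S /imsetP[f /injectiveP finj ->]; rewrite card_relabel.
- apply: leq_trans (leq_imset_card _ _) _; apply: leq_trans (max_card _) _.
  by rewrite card_ffun card_ord.
Qed.

(** With [m * n] edges the cover by all copies costs at most
    [n ^ n * p ^ (m * n) = (n * p ^ m) ^ n]. *)
Lemma not_p_small_degenerate {R : realType} {V : finType} (H : graph V) (p : R) (m : nat) :
  (0 < #|V|)%N -> (m * #|V| <= #|H|)%N -> 0 <= p <= 1 ->
  ~ p_small p (I_ #|V| H) -> 1 / 4 <= p ^+ m * #|V|%:R.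
Proof.
move=> V0 mH p01 nsmall; rewrite leNgt; apply/negP => lt; apply: nsmall.
apply: (p_small_copies p01 mH); rewrite natrX exprM -exprMn mulrC.
have [p0 p1] := andP p01.
have x0 : 0 <= p ^+ m * #|V|%:R by rewrite mulr_ge0 ?exprn_ge0.
apply: (@le_trans _ _ ((p ^+ m * #|V|%:R) ^+ 1)); last by rewrite expr1; lra.
by apply: ler_wiXn2l => //; lra.
Qed.

(** With one edge fewer than vertices the cover costs [n * (p * n) ^ (n - 1)]; the spare [n] is
    absorbed since [n / 4 ^ (n - 1) <= 1 / 2], with equality at [n = 2], whence the 1/4. The form
    [p ^+ 1] matches [scattered_degenerate] at [m = 1]. *)
Lemma not_p_small_tree {R : realType} {V : finType} (H : graph V) (p : R) :
  (1 < #|V|)%N -> (#|V|.-1 <= #|H|)%N -> 0 <= p <= 1 ->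
  ~ p_small p (I_ #|V| H) -> 1 / 4 <= p ^+ 1 * #|V|%:R.
Proof.
move=> V1 mH p01 nsmall; rewrite leNgt; apply/negP => lt; apply: nsmall.
apply: (p_small_copies p01 mH).
have [p0 p1] := andP p01; rewrite expr1 in lt.
have -> : (#|V| ^ #|V|)%:R * p ^+ #|V|.-1 = #|V|%:R * (p * #|V|%:R) ^+ #|V|.-1.
  by rewrite natrX -{2}(prednK (ltnW V1)) exprS exprMn -mulrA [_ * p ^+ _]mulrC.
apply: (@le_trans _ _ (#|V|%:R * (1 / 4) ^+ #|V|.-1)).
  rewrite ler_wpM2l ?ler0n//; apply: lerXn2r; last exact: ltW.
    by rewrite nnegrE mulr_ge0.
  by rewrite nnegrE; lra.
rewrite expr_div_n expr1n mulrA mulr1 ler_pdivrMr ?exprn_gt0//.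
rewrite -natrX mulrC mulrA mulr1 ler_pdivlMr// -natrM ler_nat.
have [n ->] : exists n, #|V| = n.+2 by exists #|V|.-2; lia.
by elim: n => //= n IH; rewrite expnS; move: (4 ^ n.+1)%N IH => x; lia.
Qed.

(** Orient each edge from [v] to [w v j]: ranks increase and out-degrees are at most [m]. The vertex
    of highest rank in [S] has no out-edge inside [S]. *)
Lemma edge_count_degenerate {V : finType} (E : {set {set V}}) (m : nat)
    (w : V -> 'I_m -> V) (rk : V -> nat) (S : {set V}) :
  (forall e, e \in E -> exists v j, e = [set v; w v j]%SET /\ (rk v < rk (w v j))%N) ->
  (edge_count E S <= m * #|S|.-1)%N.
Proof.
move=> Ew; have [->|[x0 x0S]] := set_0Vmem S.
  rewrite /edge_count (_ : [set e in E | _]%SET = set0) ?cards0//.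
  apply/setP => e; rewrite !inE; apply/negP => /andP[/Ew[v [j [-> _]]]].
  by rewrite subUset sub1set inE.
have [v0 v0S' vmax] := @arg_maxnP _ x0 (mem S) rk x0S.
have v0S : v0 \in S by [].
have -> : #|S|.-1 = #|(S :\ v0)%SET| by rewrite (cardsD1 v0 S) v0S.
rewrite mulnC -[m in leqRHS]card_ord -cardsT -cardsX.
apply: leq_trans (leq_imset_card (fun vj => [set vj.1; w vj.1 vj.2]%SET) _).
apply: subset_leq_card; apply/subsetP => e; rewrite inE => /andP[/Ew[v [j [-> lt]]]].
rewrite subUset !sub1set => /andP[vS wS]; apply/imsetP; exists (v, j) => //.
rewrite !inE /= vS !andbT; apply: contraTneq lt => e0.
by rewrite -leqNgt {2}e0; apply: vmax.
Qed.

(** By degeneracy the quantity for [S] is at least [(p ^ m * |V|) ^ (|S| - 1)], and [|S| <= k]. One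
    numerical bound thus replaces the condition on all [S]. *)
Lemma scattered_degenerate {R : realType} {V : finType} {T : eqType} (k M m : nat)
    (p : R) (A : graph V) (N : {set V}) (comp : V -> T)
    (w : V -> 'I_m -> V) (rk : V -> nat) : 0 <= p <= 1 ->
  1 / 4 <= p ^+ m * #|V|%:R ->
  (#|V| <= M * #|(~: N)%SET|)%N ->
  (forall t, (#|fiber N comp t| <= k)%N) ->
  (forall e, e \in edges A -> exists v j,
    [/\ e = [set v; w v j]%SET, (rk v < rk (w v j))%N, v \in N, w v j \in N &
        comp v = comp (w v j)]) ->
  scattered k M ((1 / 4) ^+ k) p A N comp.
Proof.
move=> p01 pm NM fk Ew; have [p0 p1] := andP p01; split=> //.
- by move=> e /Ew[v [j [-> _ vN wN _]]]; rewrite subUset !sub1set vN.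
- move=> e x y /Ew[v [j [-> _ _ _ c]]]; rewrite !inE.
  by move=> /orP[]/eqP-> /orP[]/eqP->.
- move=> S SN Scomp ecS.
  have [t tS] : exists t, t \in S.
    have /card_gt0P[e] := ecS; rewrite inE => /andP[/Ew[v [j [-> _ _ _ _]]] /subsetP s].
    by exists v; apply: s; rewrite !inE eqxx.
  have leSk : (#|S| <= k)%N.
    apply: leq_trans (fk t); apply: subset_leq_card; apply/subsetP => x xS.
    by rewrite inE (subsetP SN)//= (Scomp x t).
  apply: (@le_trans _ _ ((p ^+ m * #|V|%:R) ^+ #|S|.-1)).
    apply: (@le_trans _ _ ((1 / 4) ^+ #|S|.-1)).
      by apply: ler_wiXn2l; rewrite ?(leq_trans (leq_pred _))//; lra.
    by apply: lerXn2r => //; rewrite nnegrE ?mulr_ge0 ?exprn_ge0//; lra.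
  rewrite exprMn -exprM ler_wpM2r ?exprn_ge0// ler_wiXn2l//.
  apply: (@edge_count_degenerate _ _ _ w rk) => e /Ew[v [j [? ? _ _ _]]].
  by exists v, j.
Qed.

(** * Bounded degree trees *)

Section RootedTrees.
Context {V : finType}.
Implicit Types (H : graph V).

Lemma adj_sym H : symmetric (adj H).
Proof. by move=> x y; rewrite /adj setUC. Qed.

Lemma adj_irrefl H x : adj H x x = false.
Proof. by apply/negP => /edge_card2; rewrite setUid cards1. Qed.

Lemma edge_adj H e : e \in edges H -> exists x y, e = [set x; y]%SET /\ adj H x y.
Proof.
move=> eH; have /eqP/cards2P[x [y [_ exy]]] := edge_card2 eH.
by exists x, y; rewrite /adj -exy.
Qed.

(** A rooted tree on the subgraph induced by [Q]; the last clause says that all its edges are parent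
    edges. With [par r = r], iterating [par] stops at the root. *)
Definition parent_on H (Q : {set V}) (r : V) (par : V -> V) (dep : V -> nat) : Prop :=
  [/\ r \in Q, par r = r,
      {in Q, forall v, v != r -> [/\ par v \in Q, dep v = (dep (par v)).+1 & adj H v (par v)]}
    & {in Q &, forall u v, adj H u v -> (u != r) && (v == par u) || (v != r) && (u == par v)}].

Lemma parent_connect H Q r par dep : parent_on H Q r par dep ->
  {in Q, forall v, connect (fun x y => [&& x \in Q, y \in Q & adj H x y]) r v}.
Proof.
move=> [rQ parr parQ _] v; move: {2}(dep v) (leqnn (dep v)) => n.
elim: n v => [|n IH] v le vQ; have [->|vr] := eqVneq v r; rewrite ?connect0//;
  have [pQ dv av] := parQ v vQ vr; first by rewrite dv in le.
apply: (connect_trans (IH (par v) _ pQ)); first by rewrite dv ltnS in le.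
by apply: connect1; rewrite pQ vQ adj_sym.
Qed.

Lemma parent_extend H Q r par dep u v : acyclic H -> parent_on H Q r par dep ->
  u \in Q -> v \notin Q -> adj H u v ->
  parent_on H (v |: Q)%SET r (fun x => if x == v then u else par x)
    (fun x => if x == v then (dep u).+1 else dep x).
Proof.
move=> acH P uQ vQ auv; have conn := parent_connect P; have [rQ parr parQ adjQ] := P.
have nv x : x \in Q -> (x == v) = false by move=> xQ; apply: contraNF vQ => /eqP <-.
have vr : v != r by apply: contraNneq vQ => ->.
(* Two neighbours of [v] in [Q] are joined by a simple path inside [Q], which [v] would close to a
   cycle. *)
have uniq_nbr y : y \in Q -> adj H v y -> y = u.
  move=> yQ avy; apply/eqP/negPn/negP => yu.
  pose eQ x y := [&& x \in Q, y \in Q & adj H x y].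
  have eQsym : symmetric eQ by move=> a b; rewrite /eQ adj_sym andbCA.
  have : connect eQ u y.
    by apply: connect_trans (conn _ yQ); rewrite (sym_connect_sym eQsym) conn.
  move=> /connectP[p0 p0P ylast]; case/shortenP: p0P ylast => p pP puniq _ ylast.
  have pQ : {subset u :: p <= Q}.
    elim: p u uQ pP {puniq ylast auv yu} => [|z p IH] x xQ.
      by move=> _ ?; rewrite inE => /eqP->.
    move=> /= /andP[/and3P[_ zQ _] /(IH _ zQ) sp] t; rewrite inE => /orP[/eqP->//|].
    exact: sp.
  apply: (acH (v :: u :: p)).
    by case: p ylast {pP puniq pQ} => //= yu'; rewrite yu' eqxx in yu.
  rewrite /ucycle -[uniq _]/((v \notin u :: p) && uniq (u :: p)) puniq andbT.
  apply/andP; split; last by apply: contra vQ => /pQ.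
  rewrite /= adj_sym auv rcons_path -ylast [adj H y v]adj_sym avy andbT.
  by apply: sub_path pP => a b /and3P[].
split.
- by rewrite !inE rQ orbT.
- by rewrite nv.
- move=> x; rewrite !inE; have [->|xv] := eqVneq x v => /=.
    by rewrite uQ orbT nv// adj_sym.
  by move=> xQ xr; have [pQ dx ax] := parQ x xQ xr; rewrite nv// pQ orbT dx.
- move=> x y; rewrite !inE; have [->|xv] := eqVneq x v; have [->|yv] := eqVneq y v => //=.
  + by rewrite adj_irrefl.
  + by move=> _ yQ /(uniq_nbr _ yQ) ->; rewrite eqxx vr.
  + by move=> xQ _; rewrite adj_sym => /(uniq_nbr _ xQ) ->; rewrite eqxx vr orbT.
  + by move=> xQ yQ; exact: adjQ.
Qed.

Lemma rooted_tree H : is_tree H -> exists r par dep, parent_on H [set: V]%SET r par dep.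
Proof.
move=> [/card_gt0P[r _] connH acH].
suff Hn n : (n < #|V|)%N -> exists (Q : {set V}) par dep, #|Q| = n.+1 /\ parent_on H Q r par dep.
  have V0 : (0 < #|V|)%N by apply/card_gt0P; exists r.
  have [|Q [par [dep [cQ P]]]] := Hn #|V|.-1; first by rewrite prednK.
  exists r, par, dep; suff <- : Q = [set: V]%SET by [].
  by apply/eqP; rewrite eqEcard subsetT cardsT cQ prednK /=.
elim: n => [_|n IH ltn].
  exists [set r]%SET, (fun=> r), (fun=> 0%N); rewrite cards1; split=> //; split=> //.
  - by rewrite inE.
  - by move=> v /set1P ->; rewrite eqxx.
  - by move=> u v /set1P -> /set1P ->; rewrite adj_irrefl.
have [Q [par [dep [cQ P]]]] := IH (ltnW ltn).
have [u [v [uQ vQ auv]]] : exists u v, [/\ u \in Q, v \notin Q & adj H u v].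
  have /existsP[u /existsP[v /and3P[uQ vQ auv]]] :
      [exists u, exists v, [&& u \in Q, v \notin Q & adj H u v]]; last by exists u, v.
  apply/contraT => /existsPn nex.
  (* With no edge leaving it, [Q] is closed under adjacency and so, by connectedness, everything. *)
  have cl : fingraph.closed (adj H) (mem Q).
    have step x y : adj H x y -> x \in Q -> y \in Q.
      by move=> axy xQ; have /existsPn/(_ y) := nex x; rewrite xQ axy andbT negbK.
    by move=> x y axy; apply/idP/idP; apply: step; rewrite // adj_sym.
  have QT : Q = [set: V]%SET.
    have [rQ _ _ _] := P.
    by apply/setP => x; rewrite inE -[LHS](closed_connect cl (connH r x)) -[LHS]/(r \in Q) rQ.
  by move: ltn; rewrite -cQ QT cardsT ltnn.
exists (v |: Q)%SET, (fun x => if x == v then u else par x),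
  (fun x => if x == v then (dep u).+1 else dep x).
by rewrite cardsU1 vQ cQ; split=> //; exact: parent_extend.
Qed.

End RootedTrees.

(** Sizes of the four depth classes, each controlled by the next. Substituting leaves the additive
    constants [3 + 2 * D + D ^ 2], absorbed into half of [n]. *)
Lemma quarter_arith (D n a2 a3 a4 a5 : nat) :
  (2 * (3 + 2 * D + D ^ 2) <= n -> n <= a2 + a3 + a4 + a5 ->
   a2 <= 1 + D * a3 -> a3 <= 1 + D * a4 -> a4 <= 1 + D * a5 ->
   n <= 2 * (1 + D + D ^ 2 + D ^ 3) * a5)%N.
Proof.
move=> le0 le h2 h3 h4.
have h3' : (a3 <= 1 + D + D ^ 2 * a5)%N.
  apply: leq_trans h3 _; rewrite -addnA leq_add2l -mulnn -mulnA -[X in (_ <= X + _)%N]muln1.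
  by rewrite -mulnDr leq_mul2l h4 orbT.
have h2' : (a2 <= 1 + D + D ^ 2 + D ^ 3 * a5)%N.
  apply: leq_trans h2 _; apply: (@leq_trans (1 + D * (1 + D + D ^ 2 * a5))).
    by rewrite leq_add2l leq_mul2l h3' orbT.
  by rewrite !mulnDr muln1 mulnn (mulnA D (D ^ 2)%N) -expnS !addnA.
rewrite -mulnA !mulnDl mul1n; move: le0 le h3' h2' h4.
move: (D ^ 2 * a5)%N (D ^ 3 * a5)%N (D * a5)%N (D ^ 2)%N => b2 b3 b1 D2; lia.
Qed.

Section TreeSplitting.
Context {V : finType} (H : graph V) (r : V) (par : V -> V) (dep : V -> nat) (d : nat).
Hypothesis parP : parent_on H [set: V]%SET r par dep.
Hypothesis degH : (max_degree H <= d)%N.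

Lemma par_adj v : v != r -> adj H v (par v).
Proof. by case: parP => _ _ /(_ v (in_setT v)) h _ /h[]. Qed.

Lemma par_dep v : v != r -> dep v = (dep (par v)).+1.
Proof. by case: parP => _ _ /(_ v (in_setT v)) h _ /h[]. Qed.

Lemma edge_par e : e \in edges H -> exists2 v, v != r & e = [set v; par v]%SET.
Proof.
move=> /edge_adj[x [y [-> axy]]]; case: parP => _ _ _ /(_ x y (in_setT x) (in_setT y) axy).
by move=> /orP[/andP[? /eqP->]|/andP[? /eqP->]]; [exists x|exists y; rewrite // setUC].
Qed.

Lemma card_tree_edges : (#|V|.-1 <= #|H|)%N.
Proof.
clear degH; rewrite -card_edges.
have -> : #|V|.-1 = #|[set~ r]%SET| by rewrite cardsC1.
rewrite -(@card_in_imset _ _ (fun v => [set v; par v]%SET)).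
  by apply: subset_leq_card; apply/subsetP => _ /imsetP[v + ->]; rewrite !inE => /par_adj.
move=> u v; rewrite !inE => ur vr e.
have : u \in [set v; par v]%SET by rewrite -e !inE eqxx.
rewrite !inE => /orP[/eqP//|/eqP uv].
have : v \in [set u; par u]%SET by rewrite e !inE eqxx.
rewrite !inE => /orP[/eqP//|/eqP vu].
by have := par_dep ur; have := par_dep vr; rewrite -uv -vu; lia.
Qed.

(** Children are neighbours, at most [d] of them; the extra 1 is the root, which is its own
    parent. *)
Lemma card_preim_par (S : {set V}) : (#|[set x | par x \in S]%SET| <= d.+1 * #|S|)%N.
Proof.
rewrite -sum1_card (eq_bigl (fun x => par x \in S)) => [|x]; last by rewrite inE.
rewrite (partition_big par (mem S))//= mulnC -sum_nat_const; apply: leq_sum => y yS.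
rewrite sum1_card; apply: (@leq_trans #|(y |: [set z | adj H y z])%SET|).
  apply: subset_leq_card; apply/subsetP => x; rewrite !inE => /andP[_ /eqP<-].
  have [->|xr] := eqVneq x r; first by case: parP => _ -> _ _; rewrite eqxx.
  by rewrite adj_sym par_adj ?orbT.
apply: leq_trans (leq_card_setU _ _) _; rewrite cards1 add1n ltnS.
by apply: leq_trans degH; exact: (leq_bigmax y).
Qed.

(** Parents at residue 0 or 1: a component spans at most the levels of residue 0, 1, 2, and residue
    3 is isolated. Shifts [s = 0] and [s = 2] give the two halves. *)
Definition half_forest (s : nat) : graph V :=
  [set e : edge V | [exists v, [&& v != r, val e == [set v; par v]%SET
     & ((dep (par v) + s) %% 4 < 2)%N]]]%SET.

Definition half_vertices (s : nat) := [set v | ((dep v + s) %% 4 != 3)%N]%SET.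

Definition half_root (s : nat) (v : V) := iter ((dep v + s) %% 4)%N par v.

Lemma half_forest_cover : H \subset (half_forest 0 :|: half_forest 2)%SET.
Proof.
clear degH; apply/subsetP => e eH; have [v vr ev] := edge_par (imset_f val eH).
rewrite !inE; have [lt|ge] := ltnP ((dep (par v) + 0) %% 4)%N 2; apply/orP.
  by left; apply/existsP; exists v; rewrite vr ev eqxx.
by right; apply/existsP; exists v; rewrite vr ev eqxx/=; lia.
Qed.

(** Residue 3 being excluded, a class lies 0, 1 or 2 steps below its label: three generations of at
    most [d.+1 ^ 2] vertices. *)
Lemma card_half_fiber s t :
  (#|fiber (half_vertices s) (half_root s) t| <= 3 * d.+1 ^ 2)%N.
Proof.
pose y := half_root s t.
pose pre c := [set x | iter c par x == y]%SET.
have cpre c : (#|pre c| <= d.+1 ^ c)%N.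
  elim: c => [|c IH].
    by rewrite (_ : pre 0 = [set y]%SET) ?cards1//; apply/setP => x; rewrite !inE.
  have -> : pre c.+1 = [set x | par x \in pre c]%SET.
    by apply/setP => x; rewrite !inE iterSr.
  by rewrite expnS (leq_trans (card_preim_par _))// leq_mul2l IH orbT.
have cpre2 c : (c <= 2)%N -> (#|pre c| <= d.+1 ^ 2)%N.
  by move=> c2; rewrite (leq_trans (cpre c))// leq_pexp2l.
apply: (@leq_trans #|(pre 0 :|: pre 1 :|: pre 2)%SET|).
  apply: subset_leq_card; apply/subsetP => x; rewrite !inE /half_root -/(half_root s t) -/y.
  have := ltn_pmod (dep x + s) (isT : 0 < 4)%N.
  by case: (_ %% _)%N => [|[|[|[|]]]]//= _ ->; rewrite ?orbT.
apply: leq_trans (leq_card_setU _ _) _.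
rewrite mulSn mul2n -addnn addnC leq_add ?cpre2//.
by apply: leq_trans (leq_card_setU _ _) _; rewrite leq_add ?cpre2.
Qed.

Definition mod4_class (j : nat) := [set v | ((dep v + j) %% 4 == 0)%N]%SET.

(** Passing to the parent lowers the depth by one, hence leads to class [j.+1]; the root is the 1.
    So no class can be rare while the preceding one is large. *)
Lemma card_mod4_class j : (#|mod4_class j| <= 1 + d.+1 * #|mod4_class j.+1|)%N.
Proof.
apply: leq_trans (leq_add (leqnn 1) (card_preim_par _)).
rewrite -(cards1 r); apply: leq_trans (leq_card_setU _ _).
apply: subset_leq_card; apply/subsetP => v; rewrite !inE.
by have [//|vr] := eqVneq v r; rewrite (par_dep vr) addSnnS.
Qed.

Lemma card_half_compl s (D := d.+1) :
  (2 * (3 + 2 * D + D ^ 2) <= #|V|)%N ->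
  (#|V| <= (2 * (1 + D + D ^ 2 + D ^ 3)) * #|(~: half_vertices s)%SET|)%N.
Proof.
move=> V2.
(* Residue 3 is written [s + 5], not [s + 1], to end the chain from [s + 2] along which
   [card_mod4_class] is iterated. *)
have -> : (~: half_vertices s)%SET = mod4_class (s + 5).
  by apply/setP => v; rewrite !inE negbK; apply/eqP/eqP; lia.
have le : (#|V| <= #|mod4_class (s + 2)| + #|mod4_class (s + 3)| +
   #|mod4_class (s + 4)| + #|mod4_class (s + 5)|)%N.
  rewrite -cardsT; apply: (@leq_trans #|(mod4_class (s + 2) :|: mod4_class (s + 3) :|:
    mod4_class (s + 4) :|: mod4_class (s + 5))%SET|).
    by apply: subset_leq_card; apply/subsetP => v _; rewrite !inE; lia.
  do 3! (apply: leq_trans (leq_card_setU _ _) _; rewrite ?leq_add2r).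
  by [].
have h2 := card_mod4_class (s + 2); have h3 := card_mod4_class (s + 3).
have h4 := card_mod4_class (s + 4).
rewrite -addnS in h2; rewrite -addnS in h3; rewrite -addnS in h4.
exact: (quarter_arith V2 le h2 h3 h4).
Qed.

Lemma half_forest_embeddable {R : realType} (p : R) (s : nat) (D := d.+1) :
  0 <= p <= 1 -> 1 / 4 <= p ^+ 1 * #|V|%:R ->
  (2 * (3 + 2 * D + D ^ 2) <= #|V|)%N ->
  embeddable_half (3 * D ^ 2) (2 * (1 + D + D ^ 2 + D ^ 3))
    ((1 / 4) ^+ (3 * D ^ 2)) p (half_forest s).
Proof.
move=> p01 pV V2; exists V, (half_vertices s), (half_root s).
(* Depth reversed: edges are oriented from child to parent, and ranks must increase. *)
pose rk v := ((\max_u dep u) - dep v)%N.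
apply: (@scattered_degenerate _ _ _ _ _ 1 p _ _ _ (fun v _ => par v) rk) => //.
- exact: card_half_compl.
- exact: card_half_fiber.
move=> _ /imsetP[e + ->]; rewrite inE => /existsP[v /and3P[vr /eqP -> lt]].
have dv := par_dep vr.
exists v, ord0; split=> //.
- by rewrite /rk; have := leq_bigmax (F := dep) v; lia.
- by rewrite inE dv; lia.
- by rewrite inE; lia.
- rewrite /half_root dv addSn.
  have -> : ((dep (par v) + s).+1 %% 4 = ((dep (par v) + s) %% 4).+1)%N by lia.
  by rewrite iterSr.
Qed.

End TreeSplitting.

Lemma tree_threshold (R : realType) (d : nat) : exists C : R, 0 < C /\ exists N : nat,
  forall (n : nat) (V : finType) (H : graph V), (N <= n)%N -> #|V| = n ->
  is_tree H -> (max_degree H <= d)%N -> p_ 2 n H <= C * q_ n H.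
Proof.
pose D := d.+1; pose k := (3 * D ^ 2)%N; pose M := (2 * (1 + D + D ^ 2 + D ^ 3))%N.
pose c : R := (1 / 4) ^+ k.
have c0 : 0 < c by rewrite exprn_gt0.
exists (boost k M c); split; first by apply: lt_le_trans (boost_ge1 _ _ c0).
exists (2 + 2 * (3 + 2 * D + D ^ 2) + M * k)%N => n V H le nV treeH degH; subst n.
have [r [par [dep P]]] := rooted_tree treeH.
have V2 : (2 * (3 + 2 * D + D ^ 2) <= #|V|)%N.
  exact: leq_trans (leq_trans (leq_addl _ _) (leq_addr _ _)) le.
have V1 : (1 < #|V|)%N by apply: leq_trans le; rewrite -addnA leq_addr.
have k0 : (0 < k)%N by rewrite muln_gt0 expn_gt0.
have M0 : (0 < M)%N by rewrite muln_gt0 -!addnA.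
apply: (threshold_bound k0 M0 c0 V1); first by apply: leq_trans le; rewrite leq_addl.
move=> p p01 nsmall.
have pV := not_p_small_tree V1 (card_tree_edges P) p01 nsmall.
exists (half_forest r par dep 0), (half_forest r par dep 2); split.
- exact: (half_forest_cover P).
- exact: (half_forest_embeddable P).
- exact: (half_forest_embeddable P).
Qed.

(** * Factors *)

Lemma ffact_le_expn (m r : nat) : (m ^_ r <= m ^ r)%N.
Proof. by elim: r => // r IH; rewrite ffactnSr expnSr leq_mul// leq_subr. Qed.

(** A weak Stirling bound: [r ^ r <= (r + r) ^_ r = 'C(r + r, r) * r!], and the binomial is at most
    [4 ^ r]. *)
Lemma expn_le_fact (r : nat) : (r ^ r <= 4 ^ r * r`!)%N.
Proof.
have le_ffact m : (r ^ m <= (r + m) ^_ m)%N.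
  elim: m => [|m IH]; first by rewrite ffactn0.
  by rewrite addnS ffactSS expnS leq_mul// -addnS leq_addr.
apply: leq_trans (le_ffact r) _; rewrite -bin_ffact leq_mul2r; apply/orP; right.
rewrite (_ : 4 ^ r = 2 ^ (r + r))%N; last by rewrite expnD -expnMn.
have := expnDn 1 1 (r + r); rewrite addn1 => ->.
rewrite (bigD1 (inord r : 'I_(r + r).+1))//= inordK ?ltnS ?leq_addr//.
by rewrite !exp1n !muln1 leq_addr.
Qed.

(** * Covering by collections of disjoint pieces *)

Section FactorCover.
Context {R : realType} {U V : finType} (F : graph U) (H : graph V).
Let n := #|V|.
Let r := (#|V| %/ #|U|)%N.
Context (f : 'I_r -> U -> V).
Hypothesis f_inj : forall i, injective (f i).
Hypothesis f_disj : forall i j, i != j ->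
  [disjoint [set f i u | u : U]%SET & [set f j u | u : U]%SET].
Hypothesis f_edges : edges H = (\bigcup_i copy_edges F (f i))%SET.

Lemma f_index i j u v : f i u = f j v -> i = j.
Proof.
move=> e; apply/eqP/negPn/negP => /f_disj/pred0P/(_ (f i u))/=.
by rewrite {2}e !imset_f.
Qed.

Context (S : {set U}).
Let E := edges_in F S.
Hypothesis E_gt0 : (0 < #|E|)%N.

Let piece (g : U -> 'I_n) : graph 'I_n := lift_edges (image_edges g E).

Let E_2 e : e \in E -> #|e| = 2%N. Proof. by rewrite inE => /andP[/edge_card2]. Qed.

Let edges_piece g : injective g -> edges (piece g) = image_edges g E.
Proof.
by move=> ginj; apply: edges_lift => e /imsetP[e' /E_2 e2 ->]; rewrite card_imset.
Qed.

(** Maps are constant outside [S], so that there are [n ^ |S|] of them rather than [n ^ |U|]. *)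
Let pieces (y0 : 'I_n) : {set graph 'I_n} :=
  [set piece g | g : {ffun U -> 'I_n} in pffun_on y0 (mem S) predT]%SET.

Let piece_in y0 (g : U -> 'I_n) : piece g \in pieces y0.
Proof.
apply/imsetP; exists [ffun u => if u \in S then g u else y0].
  apply/pffun_onP; split=> //; apply/subsetP => u; rewrite !inE ffunE.
  by case: ifP; rewrite ?eqxx.
congr lift_edges; apply: eq_in_imset => e; rewrite inE => /andP[_ /subsetP eS].
by apply: eq_in_imset => u /eS uS; rewrite ffunE uS.
Qed.

Let card_pieces y0 : (#|pieces y0| <= n ^ #|S|)%N.
Proof.
by apply: leq_trans (leq_imset_card _ _) _; rewrite card_pffun_on card_ord.
Qed.

(** Every copy of [H] contains [r] disjoint copies of the piece on [S]. Choosing them unordered is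
    decisive: ['C(n ^ |S|, r) <= (4 * n ^ |S| / r) ^ r], and [n = r * |U|] turns [n ^ |S| / r] into
    [|U| * n ^ (|S| - 1)]. The 8 makes the base of the resulting power 1/2. *)
Lemma p_small_factor (p : R) : 0 <= p <= 1 -> (#|U| %| #|V|)%N -> (0 < r)%N ->
  p ^+ #|E| * n%:R ^+ #|S|.-1 <= (8 * #|U|%:R)^-1 -> p_small p (I_ n H).
Proof.
move=> p01 dvd r0 small; have [p0 p1] := andP p01.
have nE : n = (r * #|U|)%N by rewrite divnK.
have U0 : (0 < #|U|)%N by move: r0; rewrite /r; case: #|U| => //; rewrite divn0.
have S0 : (0 < #|S|)%N.
  have /card_gt0P[e eE] := E_gt0.
  have := subset_leq_card (_ : e \subset S); rewrite E_2//.
  by move: eE; rewrite inE => /andP[_ ->] /(_ isT); apply: ltn_trans.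
have n0 : (0 < n)%N by rewrite nE muln_gt0 r0.
pose y0 : 'I_n := Ordinal n0.
pose P := pieces y0.
pose draws := [set Q : {set graph 'I_n} | (Q \subset P) && (#|Q| == r)]%SET.
(* Arbitrary pieces may overlap or degenerate, so the needed number of edges is imposed on the
   cover. *)
pose G := [set A in [set (\bigcup_(J in Q) J)%SET | Q : {set graph 'I_n} in draws]%SET
  | (r * #|E| <= #|A|)%N]%SET.
apply: (@p_small_cover _ _ p _ G (r * #|E|) 'C(#|P|, r)) => //.
- apply/subsetP => A; rewrite inE => /asboolP/has_copy_relabel[h hinj sA].
  pose J i := piece (h \o f i).
  have hf i : injective (h \o f i) by exact: inj_comp.
  have disjJ i j : i != j -> [disjoint J i & J j].
    move=> ij; apply/pred0P => e /=; apply/negP => /andP[ei ej].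
    have : val e \in edges (J i) by exact: imset_f.
    have : val e \in edges (J j) by exact: imset_f.
    rewrite !edges_piece// => /imsetP[e1 e1E ve1] /imsetP[e2 e2E ve2].
    have /card_gt0P[u ue1] : (0 < #|e1|)%N by rewrite E_2.
    have : h (f j u) \in val e by rewrite ve1 (imset_f (h \o f j)).
    rewrite ve2 => /imsetP[v _ /= /hinj/f_index ji].
    by rewrite ji eqxx in ij.
  have cardJ i : #|J i| = #|E|.
    by rewrite -card_edges edges_piece// card_image_edges_inj.
  have Jinj : injective J.
    move=> i j Jij; apply/eqP/negPn/negP => /disjJ; rewrite Jij -setI_eq0 setIid.
    by rewrite -cards_eq0 cardJ -leqn0 leqNgt E_gt0.
  have cardU : #|(\bigcup_i J i)%SET| = (r * #|E|)%N.
    rewrite -sum1_card (@partition_disjoint_bigcup _ _ nat 0%N addn J (fun=> 1%N) disjJ).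
    rewrite (eq_bigr (fun=> #|E|)) => [|i _]; last by rewrite sum1_card cardJ.
    by rewrite sum_nat_const card_ord.
  apply/bigcupP; exists (\bigcup_i J i)%SET.
    rewrite inE cardU leqnn andbT; apply/imsetP; exists [set J i | i : 'I_r]%SET.
      rewrite inE card_imset// card_ord eqxx andbT.
      by apply/subsetP => _ /imsetP[i _ ->]; exact: piece_in.
    apply/setP => e; apply/bigcupP/bigcupP => [[i _ ei]|[_ /imsetP[i _ ->] ei]].
      by exists (J i); rewrite ?imset_f.
    by exists i.
  rewrite inE; apply: subset_trans sA; apply/bigcupsP => i _.
  rewrite -edgesS edges_piece// edges_relabel//.
  apply/subsetP => _ /imsetP[e eE ->].
  rewrite (imset_comp h (f i)); apply: imset_f; rewrite f_edges; apply/bigcupP; exists i => //.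
  by apply: imset_f; move: eE; rewrite inE => /andP[].
- by move=> A; rewrite inE => /andP[].
- apply: (@leq_trans #|draws|).
    apply: leq_trans (leq_imset_card (fun Q : {set graph 'I_n} => \bigcup_(J in Q) J)%SET _).
    by apply: subset_leq_card; apply/subsetP => A; rewrite inE => /andP[].
  by rewrite cards_draws.
have x0 : 0 <= p ^+ #|E| * n%:R ^+ #|S|.-1 by rewrite mulr_ge0 ?exprn_ge0.
have rr0 : 0 < (r ^ r)%:R :> R by rewrite ltr0n expn_gt0 r0.
have binle : ('C(#|P|, r) * r ^ r <= 4 ^ r * (n ^ #|S|) ^ r)%N.
  apply: (@leq_trans ('C(#|P|, r) * (4 ^ r * r`!))).
    by rewrite leq_mul2l expn_le_fact orbT.
  rewrite mulnCA bin_ffact leq_mul2l; apply/orP; right.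
  apply: (@leq_trans (#|P| ^ r)); last by rewrite leq_exp2r// card_pieces.
  exact: ffact_le_expn.
rewrite -(ler_pM2r rr0) mulrAC -natrM.
apply: (@le_trans _ _ ((4 ^ r * (n ^ #|S|) ^ r)%:R * p ^+ (r * #|E|))).
  by rewrite ler_wpM2r ?exprn_ge0// ler_nat.
have -> : (4 ^ r * (n ^ #|S|) ^ r)%:R * p ^+ (r * #|E|) =
    (4 * #|U|%:R * (p ^+ #|E| * n%:R ^+ #|S|.-1)) ^+ r * (r ^ r)%:R :> R.
  rewrite natrM !natrX [(r * _)%N]mulnC exprM -!exprMn; congr (_ ^+ _).
  have -> : n%:R ^+ #|S| = (r%:R * #|U|%:R) * n%:R ^+ #|S|.-1 :> R.
    by rewrite -natrM -nE -exprS prednK.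
  move: (n%:R ^+ _) (p ^+ _) (r%:R : R) (#|U|%:R : R) => a b c d; ring.
apply: ler_wpM2r; first exact: ltW.
apply: (@le_trans _ _ ((1 / 2) ^+ r)).
  apply: lerXn2r; rewrite ?nnegrE.
  - by rewrite mulr_ge0// mulr_ge0.
  - by rewrite divr_ge0.
  have U0' : 0 < #|U|%:R :> R by rewrite ltr0n.
  apply: (@le_trans _ _ (4 * #|U|%:R * (8 * #|U|%:R)^-1)).
    by rewrite ler_wpM2l// mulr_ge0.
  by rewrite le_eqVlt; apply/orP; left; apply/eqP; field; rewrite gt_eqF.
rewrite -[leRHS]expr1; apply: ler_wiXn2l => //.
by rewrite ler_pdivrMr// mul1r ler1n.
Qed.

End FactorCover.

Section FactorSplitting.
Context {R : realType} {U V : finType} (F : graph U) (H : graph V).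
Let r := (#|V| %/ #|U|)%N.
Context (f : 'I_r -> U -> V).
Hypothesis f_inj : forall i, injective (f i).
Hypothesis f_disj : forall i j, i != j ->
  [disjoint [set f i u | u : U]%SET & [set f j u | u : U]%SET].
Hypothesis f_edges : edges H = (\bigcup_i copy_edges F (f i))%SET.

Definition part_factor (P : pred 'I_r) : graph V :=
  lift_edges (\bigcup_(i | P i) copy_edges F (f i))%SET.

Definition part_vertices (P : pred 'I_r) : {set V} :=
  (\bigcup_(i | P i) [set f i u | u : U])%SET.

Definition part_index (v : V) : option 'I_r := [pick i | v \in [set f i u | u : U]%SET].

Lemma part_indexE i u : part_index (f i u) = Some i.
Proof.
rewrite /part_index; case: pickP => [j /imsetP[v _ e]|/(_ i)]; last by rewrite imset_f.
by rewrite (f_index f_disj e).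
Qed.

Lemma edges_part P : edges (part_factor P) = (\bigcup_(i | P i) copy_edges F (f i))%SET.
Proof.
apply: edges_lift => e /bigcupP[i _ /imsetP[e' e'F ->]].
by rewrite card_imset// (edge_card2 e'F).
Qed.

Lemma part_cover P : H \subset (part_factor P :|: part_factor (predC P))%SET.
Proof.
apply/subsetP => e eH; have := imset_f val eH : val e \in edges H.
rewrite f_edges => /bigcupP[i _ ei]; rewrite !inE; case Pi: (P i); apply/orP; [left|right].
  by apply/bigcupP; exists i.
by apply/bigcupP; exists i; rewrite //= Pi.
Qed.

Lemma card_part_compl P : (#|[pred i | ~~ P i]| * #|U| <= #|(~: part_vertices P)%SET|)%N.
Proof.
pose g (iu : 'I_r * U) := f iu.1 iu.2.
have ginj : injective g.
  move=> [i u] [j v]; rewrite /g/= => e; have ij := f_index f_disj e.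
  by subst j; rewrite (f_inj e).
have -> : (#|[pred i | ~~ P i]| * #|U|)%N = #|setX [set i | ~~ P i]%SET [set: U]%SET|.
  by rewrite cardsX cardsE cardsT.
rewrite -(card_imset _ ginj); apply: subset_leq_card.
apply/subsetP => _ /imsetP[[i u] + ->]; rewrite !inE/= andbT => nPi.
apply/bigcupP => -[j Pj /imsetP[v _ e]]; move: nPi.
by have /= -> := f_index f_disj e; rewrite Pj.
Qed.

(** A set inside one class lies in a single copy of [F] and pulls back to a subset of [U] spanning
    at least as many edges; since [p <= 1] the hypothesis on [F] transfers. *)
Lemma part_embeddable (p c : R) (P : pred 'I_r) :
  0 <= p <= 1 -> (#|U| %| #|V|)%N -> (r <= 4 * #|[pred i | ~~ P i]|)%N ->
  (forall S : {set U}, (0 < #|edges_in F S|)%N ->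
     c <= p ^+ #|edges_in F S| * #|V|%:R ^+ #|S|.-1) ->
  embeddable_half #|U| 4 c p (part_factor P).
Proof.
move=> /andP[p0 p1] dvd r4 cS; exists (option 'I_r : eqType), (part_vertices P), part_index.
have NP v : v \in part_vertices P -> exists i u, P i /\ v = f i u.
  by move=> /bigcupP[i Pi /imsetP[u _ ->]]; exists i, u.
split.
- rewrite -(divnK dvd) -/r; apply: leq_trans (_ : 4 * #|[pred i | ~~ P i]| * #|U| <= _)%N.
    by rewrite leq_mul2r r4 orbT.
  by rewrite -mulnA leq_mul2l card_part_compl orbT.
- rewrite edges_part => e /bigcupP[i Pi /imsetP[e' _ ->]].
  by apply/subsetP => _ /imsetP[u _ ->]; apply/bigcupP; exists i; rewrite // imset_f.
- rewrite edges_part => e x y /bigcupP[i Pi /imsetP[e' _ ->]].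
  by move=> /imsetP[u _ ->] /imsetP[v _ ->]; rewrite !part_indexE.
- move=> t; case ti: (part_index t) => [i|].
    rewrite -cardsT -(card_imset _ (@f_inj i)); apply: subset_leq_card.
    apply/subsetP => x; rewrite inE ti => /andP[/NP[j [u [_ ->]]]].
    by rewrite part_indexE => /eqP[->]; rewrite imset_f.
  rewrite (_ : fiber _ _ _ = set0) ?cards0//; apply/setP => x; rewrite inE ti in_set0.
  by apply/negP => /andP[/NP[j [u [_ ->]]]]; rewrite part_indexE.
- move=> S SN Scomp ecS.
  have /card_gt0P[e] := ecS; rewrite inE => /andP[/edge_card2 e2 /subsetP eS].
  have /card_gt0P[t /eS tS] : (0 < #|e|)%N by rewrite e2.
  have [i [u0 [Pi tE]]] := NP t (subsetP SN t tS).
  have Si x : x \in S -> exists u, x = f i u.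
    move=> xS; have [j [u [_ xE]]] := NP x (subsetP SN x xS).
    by have := Scomp x t xS tS; rewrite xE tE !part_indexE => -[->]; exists u.
  pose S' := (f i @^-1: S)%SET.
  have SS' : S = [set f i u | u in S']%SET.
    apply/setP => x; apply/idP/imsetP => [xS|[u + ->]]; last by rewrite inE.
    by have [u xE] := Si x xS; exists u; rewrite // inE -xE.
  have cS' : #|S| = #|S'| by rewrite {1}SS' card_imset.
  have le : (edge_count (edges (part_factor P)) S <= #|edges_in F S'|)%N.
    rewrite -(card_imset _ (imset_inj (@f_inj i))); apply: subset_leq_card.
    apply/subsetP => e1; rewrite inE edges_part.
    move=> /andP[/bigcupP[j Pj /imsetP[e' e'F ->]] /subsetP sS].
    have /card_gt0P[u ue'] : (0 < #|e'|)%N by rewrite (edge_card2 e'F).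
    have [v /(f_index f_disj) ji] := Si _ (sS _ (imset_f (f j) ue')).
    subst j; apply: imset_f; rewrite inE e'F; apply/subsetP => w we'.
    by rewrite inE sS// imset_f.
  rewrite cS'; apply: le_trans (cS S' (leq_trans ecS le)) _.
  by rewrite ler_wpM2r ?exprn_ge0// ler_wiXn2l.
Qed.

End FactorSplitting.

Lemma factor_threshold (R : realType) (U : finType) (F : graph U) : F != set0 ->
  exists C : R, 0 < C /\ exists N : nat,
  forall (n : nat) (V : finType) (H : graph V), (N <= n)%N -> #|V| = n ->
  is_factor F H -> p_ 2 n H <= C * q_ n H.
Proof.
move=> /set0Pn[e0 e0F].
have U2 : (1 < #|U|)%N by rewrite -(eqP (valP e0)) max_card.
have U0 : (0 < #|U|)%N by exact: ltnW.
pose c : R := (8 * #|U|%:R)^-1.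
have c0 : 0 < c by rewrite invr_gt0 mulr_gt0 ?ltr0n.
exists (boost #|U| 4 c); split; first by apply: lt_le_trans (boost_ge1 _ _ c0).
exists (4 * #|U|)%N => n V H le nV [dvd [f [f_inj f_disj _ f_edges]]]; subst n.
set r := (#|V| %/ #|U|)%N in f f_inj f_disj f_edges.
have r4 : (4 <= r)%N by rewrite leq_divRL.
have V1 : (1 < #|V|)%N by apply: leq_trans le; lia.
apply: (threshold_bound U0 (isT : 0 < 4)%N c0 V1 le) => p p01 nsmall.
have cS (S : {set U}) : (0 < #|edges_in F S|)%N ->
     c <= p ^+ #|edges_in F S| * #|V|%:R ^+ #|S|.-1.
  move=> E0; rewrite leNgt; apply/negP => /ltW small; apply: nsmall.
  by apply: (p_small_factor f_inj f_disj f_edges E0 p01 dvd _ small); apply: leq_trans r4.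
pose P := [pred i : 'I_r | (i < r./2)%N].
have cP : #|P| = r./2.
  have le2 : (r./2 <= r)%N by rewrite -divn2 leq_div.
  rewrite -sum1_card (eq_bigl (fun i : 'I_r => (i < r./2)%N))//.
  by rewrite (big_ord_narrow le2) sum1_card card_ord.
have := cardC P; rewrite cP card_ord => cPC.
exists (part_factor F f P), (part_factor F f (predC P)); split.
- exact: part_cover.
- apply: part_embeddable => //.
  have -> : #|[pred i | ~~ P i]| = (r - r./2)%N.
    have e : #|predC P| = #|[pred i | ~~ P i]| by apply: eq_card.
    by move: cPC; rewrite e; lia.
  by move: r4; rewrite -/r; lia.
- apply: part_embeddable => //.
  have -> : #|[pred i | ~~ predC P i]| = r./2.
    by rewrite -cP; apply: eq_card => i; rewrite !inE negbK.
  by move: r4; rewrite -/r; lia.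
Qed.

(** * Powers of Hamiltonian cycles *)

Section CyclicOrder.
Context {V : finType} (x0 : V) (c0 : seq V).
Let c := x0 :: c0.
Let n := size c.
Hypothesis c_uniq : uniq c.
Hypothesis c_all : forall x, x \in c.

Definition around (i : nat) : V := iter i (next c) x0.

Lemma card_cyclic : #|V| = n.
Proof.
have h1 := elimT card_uniqP c_uniq.
have -> : #|V| = #|c| by apply: eq_card => x; rewrite [RHS]c_all.
exact: h1.
Qed.

Lemma around_nth i : (i <= n)%N -> around i = nth x0 c i.
Proof.
elim: i => // i IH lt; rewrite -[LHS]/(next c (around i)) IH; last exact: ltnW.
by rewrite next_nth (mem_nth _ lt) index_uniq.
Qed.

Lemma aroundD i j : around (i + j) = iter i (next c) (around j).
Proof. exact: iterD. Qed.

Lemma around_modn i : around (i %% n) = around i.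
Proof.
rewrite [in RHS](divn_eq i n); elim: (i %/ n)%N => // q ->.
rewrite mulSn -addnA [in RHS]addnC [RHS]aroundD (around_nth (leqnn n)).
by rewrite nth_default.
Qed.

Lemma aroundDn i : around (i + n) = around i.
Proof. by rewrite -around_modn modnDr around_modn. Qed.

Lemma index_around i : index (around i) c = (i %% n)%N.
Proof.
have lt : (i %% n < n)%N by rewrite ltn_pmod.
by rewrite -around_modn around_nth ?(ltnW lt)// index_uniq.
Qed.

Lemma around_index x : around (index x c) = x.
Proof. by rewrite around_nth ?index_size// nth_index. Qed.

Lemma iter_next_index j x : index (iter j (next c) x) c = ((index x c + j) %% n)%N.
Proof. by rewrite -{1}(around_index x) -aroundD index_around addnC. Qed.

Lemma next_inj : injective (next c).
Proof. exact: can_inj (prev_next c_uniq). Qed.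

(** A common base [i] and two natural offsets express a signed displacement without subtraction. *)
Lemma cycle_path_around (C : graph V) (s : seq V) (x : V) :
  edges C = [set [set x; next c x]%SET | x : V]%SET -> path (adj C) x s ->
  exists i a b, [/\ x = around (i + a), last x s = around (i + b),
    (a <= b + size s)%N & (b <= a + size s)%N].
Proof.
move=> edgesC; elim: s x => [|z s IH] x /=.
  by move=> _; exists (index x c), 0%N, 0%N; rewrite addn0 around_index.
move=> /andP[xz /IH[i [a [b [zE lE ab ba]]]]].
have [zx|xz'] : z = next c x \/ x = next c z.
  have xz' : x != z by apply: contraTneq xz => ->; rewrite adj_irrefl.
  move: xz; rewrite /adj edgesC => /imsetP[y _ e].
  have xy : x \in [set y; next c y]%SET by rewrite -e !inE eqxx.
  have zy : z \in [set y; next c y]%SET by rewrite -e !inE eqxx orbT.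
  move: xy zy xz'; rewrite !inE.
  by move=> /orP[]/eqP-> /orP[]/eqP->; rewrite ?eqxx//; [left|right].
(* A forward step: [x] precedes [z], so the base moves back by one, which modulo [n] is [n.-1]
   forward. *)
- exists (i + n.-1)%N, a, b.+1; rewrite /=; split; [| |lia|lia].
  + apply: next_inj; rewrite -zx zE -[RHS]/(around (i + n.-1 + a).+1).
    by rewrite -(aroundDn (i + a)); congr around; rewrite /n/=; lia.
  + by rewrite lE -(aroundDn (i + b)); congr around; rewrite /n/=; lia.
- exists i, a.+1, b; rewrite /=; split; [|by []|lia|lia].
  by rewrite xz' zE addnS.
Qed.

End CyclicOrder.

(** * Arithmetic of blocks of positions on the cycle *)

Section Blocks.
Implicit Types (m n T i s q K : nat).
Local Open Scope nat_scope.

Lemma block_divmod K q x : x < K -> (q * K + x) %/ K = q /\ (q * K + x) %% K = x.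
Proof.
move=> xK; have K0 : 0 < K by apply: leq_ltn_trans xK.
by rewrite divnMDl// divn_small// addn0 modnMDl modn_small.
Qed.

(** Periods have length [4 * m]. Edges reach at most [m] ahead, so starts at residues below [2 * m]
    leave residues from [3 * m] on untouched, and the other starts leave [m], ..., [2 * m - 1]. The
    incomplete period after the [T] full ones goes to the second half. *)
Definition starts_first (m T i : nat) := (i < T * (4 * m)) && (i %% (4 * m) < 2 * m).

Definition covered_first (m T i : nat) := (i < T * (4 * m)) && (i %% (4 * m) < 3 * m).

Definition block_first (m i : nat) := i %/ (4 * m).

Definition covered_second (m T i : nat) :=
  ~~ [&& i < T * (4 * m), m <= i %% (4 * m) & i %% (4 * m) < 2 * m].

(* The last block of the second half wraps around position 0: the positions
   below [2 * m] are read as [n + i]. *)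
Definition unroll (m n i : nat) := if i < 2 * m then n + i else i.

Definition block_second (m n T i : nat) := minn ((unroll m n i - 2 * m) %/ (4 * m)) T.-1.

Lemma first_step m T i s : s <= m -> starts_first m T i ->
  [/\ covered_first m T i, covered_first m T (i + s), i + s < T * (4 * m)
    & block_first m (i + s) = block_first m i].
Proof.
move=> sm /andP[lt md]; set K := (4 * m) in lt md *.
have m0 : 0 < m by lia.
have K0 : 0 < K by rewrite muln_gt0.
rewrite /covered_first /block_first -/K.
have iE := divn_eq i K; set q := i %/ K in iE *; set x := i %% K in iE md *.
have qT : q < T by rewrite -(ltn_pmul2r K0); lia.
have qTK : q * K + K <= T * K by rewrite addnC -mulSn leq_mul2r qT orbT.
have [|d1 m1] := @block_divmod K q (x + s); first by rewrite /K; lia.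
rewrite iE -addnA d1 m1; split=> //; rewrite /K in qTK md *; lia.
Qed.

Lemma second_step m n T i s : 0 < s <= m -> 0 < T -> T * (4 * m) <= n -> i < n ->
  ~~ starts_first m T i ->
  [/\ covered_second m T i, covered_second m T ((i + s) %% n),
      block_second m n T ((i + s) %% n) = block_second m n T i
    & unroll m n i < unroll m n ((i + s) %% n)].
Proof.
move=> /andP[s0 sm]; case: T => // T _; rewrite mulSn => TKn ltin.
rewrite /starts_first mulSn negb_and -!leqNgt => not_first.
have m0 : 0 < m by lia.
pose K := 4 * m; have K0 : 0 < K by rewrite muln_gt0.
have KE : K = 4 * m by [].
have mod_small y : y < K -> y %% K = y by move=> yK; rewrite modn_small.
(* These are the positions where an edge can land after passing position 0. *)
have cov0 y : y < m -> covered_second m T.+1 y.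
  by move=> ym; rewrite /covered_second -/K mod_small; move: (T.+1 * K) => z; lia.
pose j := if i + s < n then i + s else i + s - n.
have jE : (i + s) %% n = j.
  rewrite /j; case: ltnP => h; first by rewrite modn_small.
  by rewrite -{1}(subnK h) modnDr modn_small; lia.
rewrite jE -/K in TKn not_first *.
have unroll_j : 2 * m <= i -> unroll m n j = i + s.
  by move=> i2; rewrite /j; case: ltnP => h; rewrite /unroll; case: ltnP => h'; lia.
have unroll_i : 2 * m <= i -> unroll m n i = i.
  by move=> i2; rewrite /unroll; case: ltnP => h'; lia.
(* Starts past the full periods all fall in the last block, thanks to the [minn]. *)
have [iTK|iTK] := ltnP i (K + T * K); last first.
  have i2 : 2 * m <= i by lia.
  rewrite /block_second unroll_j// unroll_i//.
  have big y : K + T * K <= y -> minn ((y - 2 * m) %/ K) T = T.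
    by move=> yT; apply/minn_idPr; rewrite leq_divRL//; lia.
  rewrite -/K /= !big; [|lia|lia]; split=> //; last lia.
    by rewrite /covered_second -/K mulSn ltnNge iTK.
  rewrite /j; case: ltnP => h; last by apply: cov0; lia.
  by rewrite /covered_second -/K mulSn ltnNge (leq_trans iTK) ?leq_addr.
have {not_first}mod2 : 2 * m <= i %% K by lia.
have iE := divn_eq i K; set q := i %/ K in iE; set x := i %% K in iE mod2.
have xK : x < K by exact: ltn_pmod.
have qT : q < T.+1 by rewrite -(ltn_pmul2r K0) mulSn; lia.
have i2 : 2 * m <= i by lia.
have blk y : y < K -> minn ((q * K + y) %/ K) T = q.
  by move=> /(block_divmod q)[-> _]; apply/minn_idPl; lia.
rewrite /block_second unroll_j// unroll_i// -/K /=.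
have -> : i + s - 2 * m = q * K + (x + s - 2 * m) by lia.
have -> : i - 2 * m = q * K + (x - 2 * m) by lia.
rewrite !blk; [|lia|lia]; split=> //; last lia.
  by rewrite /covered_second -/K -/x; lia.
rewrite /j; case: ltnP => h; last by apply: cov0; lia.
rewrite /covered_second -/K; have [xs|xs] := ltnP (x + s) K.
  have -> : i + s = q * K + (x + s) by lia.
  by have [_ ->] := block_divmod q xs; lia.
have -> : i + s = q.+1 * K + (x + s - K) by rewrite mulSn; lia.
by have [_ ->] := @block_divmod K q.+1 (x + s - K) ltac:(lia); lia.
Qed.

Lemma unroll_inj m n : 2 * m <= n -> {in gtn n &, injective (unroll m n)}.
Proof.
by move=> nm i j; rewrite !inE /unroll => li lj; case: ltnP => h; case: ltnP => h'; lia.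
Qed.

(** The last block also takes the incomplete period and the wrapped positions: it ends before
    [n + 2 * m], and [n] is less than [T.+1 * (4 * m)]. Hence the class size [8 * m]. *)
Lemma block_second_bound m n T i : 0 < m -> 0 < T -> i < n ->
  T * (4 * m) <= n -> n < T.+1 * (4 * m) ->
  block_second m n T i * (4 * m) + 2 * m <= unroll m n i
    < block_second m n T i * (4 * m) + 10 * m.
Proof.
move=> m0; case: T => // T _ lin TKn nTK; rewrite /block_second /=.
set y := unroll m n i; pose K := 4 * m; have K0 : 0 < K by rewrite muln_gt0.
have KE : K = 4 * m by [].
rewrite -/K in TKn nTK *; rewrite !mulSn in nTK; rewrite mulSn in TKn.
have y2 : 2 * m <= y by rewrite /y /unroll; case: ltnP; lia.
have yn : y < n + 2 * m by rewrite /y /unroll; case: (ltnP i (2 * m)); lia.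
have yE := divn_eq (y - 2 * m) K; have := ltn_pmod (y - 2 * m) K0.
set x := _ %% K in yE *; set q := _ %/ K in yE * => xK.
have [le|lt] := leqP q T; first lia.
have : T * K <= q * K by rewrite leq_mul2r (ltnW lt) orbT.
by lia.
Qed.

End Blocks.

Lemma leq_card_of_injection {V : finType} (S : {set V}) (g : V -> nat) (b : nat) :
  {in S &, injective g} -> (forall x, x \in S -> (g x < b)%N) -> (#|S| <= b)%N.
Proof.
case: b => [|b] ginj gb.
  by rewrite leqn0 cards_eq0; apply/eqP/setP => x; rewrite inE; apply/negP => /gb.
rewrite -[leqRHS]card_ord -(@card_in_imset _ _ (fun x => inord (g x) : 'I_b.+1)) ?max_card//.
move=> x y xS yS /(congr1 val) /=; rewrite !inordK ?gb//; exact: ginj.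
Qed.

Section PowerSplitting.
Context {V : finType} (x0 : V) (c0 : seq V) (m : nat) (C H : graph V).
Let c := x0 :: c0.
Let n := size c.
Hypothesis c_uniq : uniq c.
Hypothesis c_all : forall x, x \in c.
Hypothesis C_edges : edges C = [set [set x; next c x]%SET | x : V]%SET.
Hypothesis H_power : forall x y, x != y -> adj H x y <-> distance_le C m x y.
Hypothesis m_gt0 : (0 < m)%N.
Hypothesis n_large : (2 * m < n)%N.

Definition later (v : V) (j : 'I_m) : V := iter j.+1 (next c) v.

Lemma index_later v j : index (later v j) c = ((index v c + j.+1) %% n)%N.
Proof. exact: iter_next_index. Qed.

Lemma index_inj_c : injective (index^~ c).
Proof. by move=> x y e; apply: (@index_inj _ x c); rewrite ?c_all. Qed.

Lemma index_lt x : (index x c < n)%N.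
Proof. by rewrite index_mem. Qed.

Lemma power_edge e : e \in edges H -> exists v j, e = [set v; later v j]%SET.
Proof.
move=> /edge_adj[x [y [-> axy]]].
have xy : x != y by apply: contraTneq axy => ->; rewrite adj_irrefl.
have /(H_power xy)[s [sP sl sm]] := axy.
have [i [a [b [xE yE ab ba]]]] := cycle_path_around c_uniq c_all C_edges sP.
rewrite sl in yE.
have shift k d : (0 < d <= m)%N -> exists j : 'I_m,
    around x0 c0 (i + (k + d)) = later (around x0 c0 (i + k)) j.
  move=> /andP[d0 dm]; have dj : (d.-1 < m)%N by lia.
  exists (Ordinal dj); rewrite /later.
  have -> : (Ordinal dj).+1 = d by exact: prednK.
  by rewrite addnA addnC aroundD.
have [le|/ltnW le] := leqP a b.
  have ne : a <> b by move=> eab; move: xy; rewrite xE yE eab eqxx.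
  have [|j je] := shift a (b - a)%N; first by lia.
  by exists x, j; rewrite xE -je subnKC // yE.
have ne : a <> b by move=> eab; move: xy; rewrite xE yE eab eqxx.
have [|j je] := shift b (a - b)%N; first by lia.
by exists y, j; rewrite setUC yE -je subnKC // xE.
Qed.

Lemma later_edge v j : [set v; later v j]%SET \in edges H.
Proof.
have jm := ltn_ord j.
rewrite -[_ \in _]/(adj H v (later v j)); apply/H_power.
  apply/eqP => /(congr1 (index^~ c)); rewrite index_later => e.
  have := index_lt v; rewrite {1}e.
  have [lt|ge] := ltnP (index v c + j.+1) n; first by rewrite modn_small// in e; lia.
  by move: e; rewrite -{1}(subnK ge) modnDr modn_small; have := index_lt v; lia.
exists (traject (next c) (next c v) j.+1); split.
- apply: sub_path (fpath_traject (next c) v j.+1) => x y /eqP <-.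
  by rewrite /adj C_edges; apply/imsetP; exists x.
- by rewrite last_traject.
- by rewrite size_traject.
Qed.

(** The pairs [(v, j)] give distinct edges: the same edge read from its other end would need two
    steps of total length at most [2 * m] to go around the cycle. *)
Lemma card_power_edges : (m * #|V| <= #|H|)%N.
Proof.
pose g (vj : V * 'I_m) := [set vj.1; later vj.1 vj.2]%SET.
have ginj : injective g.
  move=> [v j] [v' j']; rewrite /g /= => e.
  have jm := ltn_ord j; have jm' := ltn_ord j'.
  have cancel a x y : (x < n)%N -> (y < n)%N -> ((a + x) %% n = (a + y) %% n -> x = y)%N.
    by move=> xn yn /eqP; rewrite eqn_modDl !modn_small// => /eqP.
  have : v \in [set v'; later v' j']%SET by rewrite -e !inE eqxx.
  rewrite !inE => /orP[/eqP vv|/eqP vv].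
    subst v'; have : later v j \in [set v; later v j']%SET by rewrite -e !inE eqxx orbT.
    have nv : later v j != v.
      by have /edge_card2 := later_edge v j; rewrite cards2 eq_sym; case: eqVneq.
    rewrite !inE (negbTE nv) => /eqP/(congr1 (index^~ c)); rewrite !index_later.
    move=> /cancel h; have/eqP := h ltac:(lia) ltac:(lia); rewrite eqSS => /eqP jj.
    by congr pair; apply: val_inj.
  have : v' \in [set v; later v j]%SET by rewrite e !inE eqxx.
  rewrite !inE => /orP[/eqP vv'|/eqP vv'].
    have /edge_card2 := later_edge v' j'; rewrite -vv vv' cards2 eqxx //.
  have := congr1 (index^~ c) vv; rewrite index_later vv' index_later modnDml -addnA => i1.
  have : (0 = j.+1 + j'.+1)%N; last by [].
  apply: (@cancel (index v c)); [lia|lia|].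
  by rewrite addn0 -i1 modn_small ?index_lt.
rewrite mulnC -[m in leqLHS]card_ord -card_prod -cardsT -(card_imset _ ginj) -card_edges.
by apply: subset_leq_card; apply/subsetP => _ /imsetP[[v j] _ ->]; exact: later_edge.
Qed.

Definition part_power (P : pred nat) : graph V :=
  [set e : edge V | [exists v, exists j : 'I_m,
     (val e == [set v; later v j]%SET) && P (index v c)]]%SET.

Lemma part_power_cover P : H \subset (part_power P :|: part_power (predC P))%SET.
Proof.
apply/subsetP => e eH; have [v [j ve]] := power_edge (imset_f val eH).
rewrite !inE; case Pv: (P (index v c)); apply/orP; [left|right];
  by apply/existsP; exists v; apply/existsP; exists j; rewrite ve eqxx /= Pv.
Qed.

Lemma edges_part_power P e : e \in edges (part_power P) ->
  exists v j, e = [set v; later v j]%SET /\ P (index v c).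
Proof.
move=> /imsetP[e' + ->]; rewrite inE => /existsP[v /existsP[j /andP[/eqP -> Pv]]].
by exists v, j.
Qed.

Let T := (n %/ (4 * m))%N.

(* Each of the [T] periods of length [4 * m] contains the [m] positions
   [o, ..., o + m - 1], taken modulo [4 * m]. *)
Lemma card_missed (N : {set V}) (o : nat) : (0 < T)%N -> (o + m <= 4 * m)%N ->
  (forall v, (index v c < T * (4 * m))%N -> (o <= index v c %% (4 * m) < o + m)%N -> v \notin N) ->
  (#|V| <= 8 * #|(~: N)%SET|)%N.
Proof.
move=> T0 om missed; rewrite (card_cyclic c_uniq c_all) -/c -/n.
have TKn : (T * (4 * m) <= n)%N by exact: leq_trunc_div.
have nTK : (n < T.+1 * (4 * m))%N by rewrite ltn_ceil// muln_gt0.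
pose g (ta : 'I_T * 'I_m) := nth x0 c (ta.1 * (4 * m) + (o + ta.2)).
have glt (ta : 'I_T * 'I_m) : (ta.1 * (4 * m) + (o + ta.2) < T * (4 * m))%N.
  have := ltn_ord ta.2 => lt2; have lt1 := ltn_ord ta.1.
  have : (ta.1.+1 * (4 * m) <= T * (4 * m))%N by rewrite leq_mul2r lt1 orbT.
  by rewrite mulSn; lia.
have block (ta : 'I_T * 'I_m) : (o + ta.2 < 4 * m)%N.
  by have := ltn_ord ta.2; lia.
have ginj : injective g.
  move=> ta tb /eqP; rewrite nth_uniq ?(leq_trans (glt _) TKn)// => /eqP e.
  have [da ma] := block_divmod ta.1 (block ta).
  have [db mb] := block_divmod tb.1 (block tb).
  move: da ma; rewrite e db mb => e1 /addnI e2.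
  by case: ta tb e1 e2 {e db mb} => [t a] [t' a'] /= /val_inj-> /val_inj->.
have : (T * m <= #|(~: N)%SET|)%N.
  rewrite -[T]card_ord -[X in (_ * X)%N]card_ord -card_prod -cardsT -(card_imset _ ginj).
  apply: subset_leq_card; apply/subsetP => _ /imsetP[ta _ ->]; rewrite inE.
  have lt := leq_trans (glt ta) TKn.
  apply: missed; rewrite index_uniq//.
  have [_ ->] := block_divmod ta.1 (block ta).
  by rewrite leq_addr ltn_add2l ltn_ord.
(* As [T >= 1], [n < T.+1 * (4 * m) <= 8 * (T * m)]. *)
have : (4 * m <= T * (4 * m))%N by rewrite leq_pmull.
move: nTK; rewrite mulSn mulnCA; move: (T * m)%N => z; lia.
Qed.

Lemma first_embeddable {R : realType} (p : R) : (0 < T)%N -> 0 <= p <= 1 ->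
  1 / 4 <= p ^+ m * #|V|%:R ->
  embeddable_half (8 * m) 8 ((1 / 4) ^+ (8 * m)) p (part_power (starts_first m T)).
Proof.
move=> T0 p01 pV.
have TKn : (T * (4 * m) <= n)%N by exact: leq_trunc_div.
exists nat, [set v | covered_first m T (index v c)]%SET, (fun v => block_first m (index v c)).
apply: (@scattered_degenerate _ _ _ _ _ m p _ _ _ later (index^~ c)) => //.
- apply: (@card_missed _ (3 * m)) => //; first lia.
  by move=> v lt /andP[le _]; rewrite inE /covered_first lt -leqNgt.
- move=> t; apply: (@leq_card_of_injection _ _ (fun v => index v c %% (4 * m))%N) => [x y|x _].
    rewrite !inE /block_first => /andP[_ /eqP xt] /andP[_ /eqP yt] e.
    apply: index_inj_c; rewrite (divn_eq (index x c) (4 * m)) (divn_eq (index y c) (4 * m)).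
    by rewrite xt yt e.
  have : (index x c %% (4 * m) < 4 * m)%N by rewrite ltn_pmod// muln_gt0.
  lia.
- move=> e /edges_part_power[v [j [-> Pv]]]; exists v, j.
  have [c1 c2 lt ble] := first_step (ltn_ord j) Pv.
  have jE : index (later v j) c = (index v c + j.+1)%N.
    by rewrite index_later modn_small// (leq_trans lt).
  by split; rewrite // ?inE ?jE//; lia.
Qed.

(** The rank is the unrolled position, because the index drops when an edge passes position 0. *)
Lemma second_embeddable {R : realType} (p : R) : (0 < T)%N -> 0 <= p <= 1 ->
  1 / 4 <= p ^+ m * #|V|%:R ->
  embeddable_half (8 * m) 8 ((1 / 4) ^+ (8 * m)) p (part_power (predC (starts_first m T))).
Proof.
move=> T0 p01 pV.
have TKn : (T * (4 * m) <= n)%N by exact: leq_trunc_div.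
have nTK : (n < T.+1 * (4 * m))%N by rewrite ltn_ceil// muln_gt0.
exists nat, [set v | covered_second m T (index v c)]%SET,
  (fun v => block_second m n T (index v c)).
apply: (@scattered_degenerate _ _ _ _ _ m p _ _ _ later (fun v => unroll m n (index v c))) => //.
- apply: (@card_missed _ m) => //; first lia.
  move=> v lt /andP[le1 le2]; rewrite inE /covered_second lt le1 negbK /=.
  by move: le2; rewrite mul2n addnn.
- move=> t; set q := block_second m n T (index t c).
  apply: (@leq_card_of_injection _ _
    (fun v => unroll m n (index v c) - (q * (4 * m) + 2 * m))%N) => [x y|x].
    rewrite !inE => /andP[_ /eqP xt] /andP[_ /eqP yt].
    have := block_second_bound m_gt0 T0 (index_lt x) TKn nTK.
    have := block_second_bound m_gt0 T0 (index_lt y) TKn nTK.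
    rewrite xt yt -/q => /andP[ly _] /andP[lx _] e.
    apply: index_inj_c; apply: (unroll_inj (ltnW n_large)); rewrite ?inE ?index_lt//.
    by move: e; rewrite -/c; lia.
  rewrite !inE => /andP[_ /eqP xt].
  have := block_second_bound m_gt0 T0 (index_lt x) TKn nTK.
  by rewrite xt -/q => /andP[l u]; rewrite -/c; lia.
- move=> e /edges_part_power[v [j [-> Pv]]]; exists v, j.
  have j01 : (0 < j.+1 <= m)%N by have := ltn_ord j.
  have [c1 c2 ble lt] := second_step j01 T0 TKn (index_lt v) Pv.
  by split; rewrite ?inE ?index_later.
Qed.

End PowerSplitting.

Lemma power_threshold (R : realType) (m : nat) : (1 <= m)%N ->
  exists C : R, 0 < C /\ exists N : nat,
  forall (n : nat) (V : finType) (H : graph V), (N <= n)%N -> #|V| = n ->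
  is_hamiltonian_cycle_power m H -> p_ 2 n H <= C * q_ n H.
Proof.
move=> m0.
pose e : R := (1 / 4) ^+ (8 * m).
have e0 : 0 < e by rewrite exprn_gt0.
exists (boost (8 * m) 8 e); split; first by apply: lt_le_trans (boost_ge1 _ _ e0).
exists (8 * (8 * m))%N => n V H le nV [C [c [c2 c_uniq c_all C_edges]] H_power]; subst n.
case: c c2 c_uniq c_all C_edges => // x0 c0 c2 c_uniq c_all C_edges.
have V_c := card_cyclic c_uniq c_all.
have V1 : (1 < #|V|)%N by lia.
have n_large : (2 * m < size (x0 :: c0))%N by rewrite -V_c; lia.
have T0 : (0 < size (x0 :: c0) %/ (4 * m))%N by rewrite divn_gt0 -?V_c; lia.
have k0 : (0 < 8 * m)%N by lia.
apply: (threshold_bound k0 (isT : 0 < 8)%N e0 V1 le) => p p01 nsmall.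
have V0 := ltnW V1.
have mH := card_power_edges c_uniq c_all C_edges H_power m0 n_large.
have pV := not_p_small_degenerate V0 mH p01 nsmall.
set P := starts_first m (size (x0 :: c0) %/ (4 * m)).
exists (part_power x0 c0 m P), (part_power x0 c0 m (predC P)); split.
- exact: (part_power_cover c_uniq c_all C_edges H_power m0 n_large).
- exact: first_embeddable.
- exact: second_embeddable.
Qed.

Theorem theorem1p11 (R : realType) :
  [/\ (forall d : nat, exists C : R, 0 < C /\ exists N : nat,
         forall (n : nat) (V : finType) (H : graph V),
           (N <= n)%N -> #|V| = n ->
           is_tree H -> (max_degree H <= d)%N ->
           p_ 2 n H <= C * q_ n H),
      (forall m : nat, (1 <= m)%N -> exists C : R, 0 < C /\ exists N : nat,
         forall (n : nat) (V : finType) (H : graph V),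
           (N <= n)%N -> #|V| = n ->
           is_hamiltonian_cycle_power m H ->
           p_ 2 n H <= C * q_ n H)
    & (forall (U : finType) (F : graph U), F != finset.set0 ->
         exists C : R, 0 < C /\ exists N : nat,
         forall (n : nat) (V : finType) (H : graph V),
           (N <= n)%N -> #|V| = n ->
           is_factor F H ->
           p_ 2 n H <= C * q_ n H)].

Proof.
split=> [d|m m1|U F F0]; [exact: tree_threshold|exact: power_threshold|].
exact: factor_threshold.
Qed.
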